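(* Fix an accuracy $\varepsilon>0$ and a leaf size $n_{\max}$ independent of $N$. Let $A$ be an $N\times N$ system matrix in the setting described in the context (kernel matrix on a regular grid in a rectangle in the plane, organized by a uniform binary tree), and let Assumptions 1-4 and the dense-block and compressed-block algorithms be as described in the context. Then, as $N\to\infty$: (i) (Dense-block algorithms.) If Assumptions 1-3 hold, the dense-block tree build and inverse compression algorithms perform $O(N^{3/2})$ work. For non-translation-invariant (NTI) kernels, the storage requirements and the work of the matrix apply are both $O(N\log N)$. For translation-invariant (TI) kernels, the storage is $O(N)$ and the work of the matrix apply is $O(N\log N)$. (ii) (NTI compressed-block algorithms.) If $A$ is non-translation-invariant and Assumptions 1-4 hold, then the compressed-block tree build, inverse compression and HSS apply all perform $O(N)$ work and require $O(N)$ storage. (iii) (TI compressed-block algorithms.) If $A$ is translation-invariant and Assumptions 1-4 hold, then the compressed-block tree build, inverse compression and HSS apply all perform $O(N)$ work and require $O(N)$ storage. In fact, the inverse compression work and storage are sublinear, namely $O(N^{1/2}\log_2^2 N)$ and $O(N^{1/2}\log_2 N)$, respectively.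
   Context: **Setting.** $A$ is an $N\times N$ matrix obtained by evaluating a kernel $K(p,q)$ at pairs of $N$ sample points of a regular grid in a rectangle in $\mathbb R^2$. For sets of points $X,Y$, $K[X,Y]$ is the matrix of kernel values; for index sets $I,J$, $A(I,J)$ is the corresponding submatrix. The rectangle is recursively bisected into boxes $B_i$ forming a uniform binary tree with levels $\ell=0,\dots,d$, $d=\log_2(N/n_{\max})$. Level $\ell$ has $2^\ell$ boxes with at most $n_\ell=2^{-\ell}N$ points each. The children of $B_i$ are $c_1(i),c_2(i)$. **Skeletons and interpolation.** For a leaf, $I_i$ is the set of indices of points in $B_i$; for a non-leaf, $I_i=I^{sk}_{c_1(i)}\sqcup I^{sk}_{c_2(i)}$. Each $I_i$ is split as $I_i=I_i^{sk}\sqcup I_i^{rs}$ into a skeleton set ($I_i^{sk}$, points within a fixed number of layers of the boundary of $B_i$) and a residual set $I_i^{rs}$. The points are $X_i^{sk},X_i^{rs}$, and $m_i=|I_i|$, $k_i=|I_i^{sk}|$. With a set $Z_i$ of proxy points in a thin layer just outside $B_i$, $|Z_i|=k_i$, the $k_i\times(m_i-k_i)$ interpolation matrix $T_i$ solves $K[Z_i,X_i^{sk}]\,T_i=K[Z_i,X_i^{rs}]$; one such matrix $T_i^{up}$ is built for columns and one, $T_i^{dn}$, for rows. With skeleton indices ordered first, $R_i=[\,I\;\;T_i^{up}\,]$ and $L_i=\begin{bmatrix} I \\ (T_i^{dn})^T \end{bmatrix}$. ''Tree build'' means computing the index sets and the matrices $T_i^{up},T_i^{dn}$ for the boxes. **Inverse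 compression.** Boxes are processed from fine to coarse. For a leaf, $F_i=A(I_i,I_i)$. For a non-leaf, $$F_i=\begin{bmatrix} E_{c_1(i)} & A(I^{sk}_{c_1(i)},I^{sk}_{c_2(i)}) \\ A(I^{sk}_{c_2(i)},I^{sk}_{c_1(i)}) & E_{c_2(i)} \end{bmatrix}.$$ For non-root boxes, $E_i=(R_iF_i^{-1}L_i)^{-1}$; at the root only $F_i^{-1}$ is needed. All inverses are assumed to exist. Write $$F_i=\begin{bmatrix} F_i^{sk} & F_i^{s\leftarrow r} \\ F_i^{r\leftarrow s} & F_i^{rs} \end{bmatrix},\quad S_i^{rs}=F_i^{sk}-F_i^{s\leftarrow r}(F_i^{rs})^{-1}F_i^{r\leftarrow s},\quad F_i^{-1}=\begin{bmatrix} \phi_i^{sk} & \phi_i^{s\leftarrow r} \\ \phi_i^{r\leftarrow s} & \phi_i^{rs} \end{bmatrix}$$ with respect to $I_i^{sk}\sqcup I_i^{rs}$, so that $\phi_i^{sk}=(S_i^{rs})^{-1}$ and $$E_i^{-1}=\phi_i^{sk}+T_i^{up}\phi_i^{r\leftarrow s}+\phi_i^{s\leftarrow r}(T_i^{dn})^T+T_i^{up}\phi_i^{rs}(T_i^{dn})^T.$$ **Matrix apply / HSS apply.** The compressed inverse is applied to a vector $f$ by an upward pass ($u_i=f(I_i)$ on leaves, $u_i$ the concatenation of $u^{up}_{c_1(i)},u^{up}_{c_2(i)}$ otherwise; $u_i^{up}=E_iR_iF_i^{-1}u_i$) and a downward pass (at the root, the vector $F_i^{-1}u_i$ is split into $\phi_{c_1(i)},\phi_{c_2(i)}$;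 at every other box, $F_i^{-1}(u_i-L_iu_i^{up}+L_iE_i\phi_i)$ is computed, which is split into $\phi_{c_1(i)},\phi_{c_2(i)}$ for a non-leaf and is the output on $I_i$ for a leaf). **Dense-block algorithms.** All matrices $T_i^{up},T_i^{dn},F_i^{-1},E_i$ are computed and stored as dense matrices using standard dense linear algebra (cubic cost for factorization, inversion and products of matrices of size $O(m)$, quadratic cost for storage and matrix-vector products). **Compressed-block algorithms.** Two formats are used: low-rank factorization, and one-dimensional HSS (''HSS1D'') format. A matrix is in HSS (hierarchically semi-separable) form if it has a telescoping factorization $D^{d'}+L^{d'}(D^{d'-1}+L^{d'-1}(\cdots(D^1+L^1D^0R^1)\cdots)R^{d'-1})R^{d'}$ with block-diagonal $D^j,L^j,R^j$ whose blocks correspond to the boxes at level $j$ of a binary tree on the indices. HSS1D means that the index set is ordered along a curve (box boundary or interface between sibling boxes). - Tree build: $K[Z_i,X_i^{sk}]$ is compressed and inverted as HSS1D; $K[Z_i,X_i^{rs}]$ is compressed as HSS1D and then as low-rank by a randomized interpolative decomposition (ID); $T_i=K[Z_i,X_i^{sk}]^{-1}K[Z_i,X_i^{rs}]$ is obtained in low-rank form by HSS1D-times-low-rank multiplication. - $F_i^{-1}$ (non-leaf): the HSS1D forms of $E_{c_1(i)},E_{c_2(i)}$ are split into skeleton and residual diagonal parts and merged; the off-diagonal kernel blocks are compressed as HSS1D and added, giving $F_i^{sk},F_i^{rs}$ in HSS1D form; $F_i^{rs}$ is inverted in HSS1D form; $F_i^{s\leftarrow r},F_i^{r\leftarrow s}$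 are compressed to low rank by randomized ID; the low-rank correction in $S_i^{rs}$ is formed by HSS1D/low-rank products, converted to HSS1D, added to $F_i^{sk}$, and $S_i^{rs}$ is inverted in HSS1D form. The blocks stored are $(F_i^{rs})^{-1},(S_i^{rs})^{-1}$ (HSS1D) and $F_i^{s\leftarrow r},F_i^{r\leftarrow s}$ (low-rank). Leaves, of size at most $n_{\max}$, are handled densely. - $E_i$: the last three terms of $E_i^{-1}$ are formed as low-rank matrices, recompressed, converted to HSS1D, added to $(S_i^{rs})^{-1}$, and the sum is inverted in HSS1D form; $E_i$ is stored in HSS1D form. - Each HSS1D sum is followed by HSS1D recompression. The HSS apply uses the stored HSS1D and low-rank blocks for all matrix-vector products. **NTI and TI.** In the non-translation-invariant (NTI) case, one set of matrices is computed and stored for each box. In the translation-invariant (TI) case the matrices are the same for all boxes of a level, so only one set of matrices is computed and stored per level; applies still operate on all boxes. **Assumptions.** 1. (Skeleton size scaling) The maximum size of skeleton sets of boxes at level $\ell$ is $O(n_\ell^{1/2})$. 2. (Localization) Equivalent densities on proxy points may be used to represent long-range interactions to within any specified accuracy: the columns of $K[Z_i,\cdot]$-type interactions with $O(k_i)$ proxy points in a thin layer around $B_i$ suffice, to accuracy $\varepsilon$, to represent the interactions of $B_i$ with all points outside $B_i$. 3. (Skeleton structure) The skeleton set of any box may be chosen from within a thin layer of points close to the boundary of the box. 4. (Compressed block structure) The blocks of $F_i$ and $E_i$ (and the matrices in the tree build: $K[Z_i,X_i^{sk}]$ as HSS1D, $K[Z_i,X_i^{rs}]$ as low-rank) have one-dimensional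 HSS or low-rank structure as indicated above, with ranks $O(\log n_\ell)$ at level $\ell$. The HSS1D blocks behave like HSS matrices of boundary integral operators on curves, for which all one-dimensional HSS operations (compression, inversion, sum, split, merge, recompression, matrix-vector product) have work and storage linear in the matrix size. **Cost conventions.** For matrices of size $O(m)$: the product of an HSS1D matrix and a rank-$q$ matrix costs $O(mq)$; matrix-vector multiplication with, and storage of, a rank-$q$ matrix cost $O(mq)$; randomized ID, conversion of a rank-$q$ matrix to HSS1D, and products and recompression of rank-$q$ matrices cost $O(mq^2+q^3)$. Work is the number of arithmetic operations and storage is the number of stored matrix entries. Implied constants in $O(\cdot)$ may depend on $\varepsilon$, $n_{\max}$ and the constants in the assumptions, but not on $N$. *)

(* Defs.v *)
From mathcomp Require Import all_boot all_order all_algebra.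
From mathcomp Require Import reals exp.
From Stdlib Require List.

Set Implicit Arguments.
Unset Strict Implicit.
Unset Printing Implicit Defensive.
Import Order.TTheory GRing.Theory Num.Theory.
Local Open Scope ring_scope.

Section Matrices.
Context {R : realType} {F : numFieldType}.

Definition pt : Type := (R * R)%type.

(* Matrices and vectors are labelled by points of the plane; the index sets
   are lists of points, so that K[X,Y], A(I,J) and the blocks of a matrix are
   all [mx X Y _] of one labelled matrix. A labelled matrix is only meaningful
   on the pair of index lists it is used with. *)
Definition lmx : Type := pt -> pt -> F.
Definition vec : Type := pt -> F.

Definition mx (X Y : seq pt) (M : lmx) : 'M[F]_(size X, size Y) :=
  \matrix_(a, b) M (nth 0 X a) (nth 0 Y b).

(* [mx X Y M] seen as a square matrix, for [size X = size Y]. *)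
Definition sqmx (X Y : seq pt) (M : lmx) : 'M[F]_(size X) :=
  \matrix_(a, b) M (nth 0 X a) (nth 0 Y b).

Definition linv (X Y : seq pt) (M : lmx) : lmx := fun y x =>
  match insub (index y Y), insub (index x X) with
  | Some a, Some b => invmx (sqmx X Y M) a b
  | _, _ => 0
  end.

Definition ltrans (M : lmx) : lmx := fun p q => M q p.
Definition lmul (Y : seq pt) (M P : lmx) : lmx :=
  fun p r => \sum_(q <- Y) M p q * P q r.
Definition lapp (Y : seq pt) (M : lmx) (v : vec) : vec :=
  fun p => \sum_(q <- Y) M p q * v q.
Definition lshift (t : pt) (M : lmx) : lmx := fun p q => M (p - t) (q - t).

Definition close (delta : F) (X Y : seq pt) (M M' : lmx) : Prop :=
  forall p q, p \in X -> q \in Y -> `|M p q - M' p q| <= delta.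

(* The low-rank format: the first [lrk] columns of [lU] times the first
   [lrk] rows of [lV]. *)
Record lowrank := LR { lrk : nat; lU : pt -> nat -> F; lV : nat -> pt -> F }.

Definition lr_val (A : lowrank) : lmx :=
  fun p q => \sum_(0 <= j < lrk A) lU A p j * lV A j q.
Definition lr_trans (A : lowrank) : lowrank :=
  LR (lrk A) (fun p j => lV A j p) (fun j p => lU A p j).
Definition lr_shift (t : pt) (A : lowrank) : lowrank :=
  LR (lrk A) (fun p j => lU A (p - t) j) (fun j p => lV A j (p - t)).
Definition lr_opp (A : lowrank) : lowrank :=
  LR (lrk A) (fun p j => - lU A p j) (lV A).
Definition lr_add (A B : lowrank) : lowrank :=
  LR (lrk A + lrk B)
     (fun p j => if (j < lrk A)%N then lU A p j else lU B p (j - lrk A)%N)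
     (fun j q => if (j < lrk A)%N then lV A j q else lV B (j - lrk A)%N q).
Definition lr_mul (Y : seq pt) (A B : lowrank) : lowrank :=
  LR (lrk A) (lU A)
     (fun j r => \sum_(0 <= l < lrk B)
                   (\sum_(q <- Y) lV A j q * lU B q l) * lV B l r).
Definition lr_mull (Y : seq pt) (H : lmx) (A : lowrank) : lowrank :=
  LR (lrk A) (fun p j => \sum_(q <- Y) H p q * lU A q j) (lV A).
Definition lr_mulr (Y : seq pt) (A : lowrank) (H : lmx) : lowrank :=
  LR (lrk A) (lU A) (fun j r => \sum_(q <- Y) lV A j q * H q r).

Definition num_rank (delta : F) (X Y : seq pt) (q : nat) (M : lmx) : Prop :=
  exists A : lowrank, lrk A = q /\ close delta X Y M (lr_val A).

Definition block_diag s t (rn : 'I_s -> nat) (cn : 'I_t -> nat)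
  (D : 'M[F]_(s, t)) : Prop := forall x y, rn x <> cn y -> D x y = 0.

(* The telescoping factorization D^j + L^j (...) R^j. [rn] and [cn] give the
   level-j block of a row and of a column; [ro] and [co] give the level-j block
   that a row or a column of the level j-1 core comes from, and the blocks of
   level j-1 are the parents of those. *)
Inductive hss_tel (q : nat) : nat -> forall s t : nat,
    ('I_s -> nat) -> ('I_t -> nat) -> 'M[F]_(s, t) -> Prop :=
| Hss_top s t (rn : 'I_s -> nat) (cn : 'I_t -> nat) (D : 'M[F]_(s, t)) :
    (forall x, rn x = 0%N) -> (forall y, cn y = 0%N) ->
    hss_tel q 0 rn cn D
| Hss_level j s t s' t' (rn : 'I_s -> nat) (cn : 'I_t -> nat)
    (ro : 'I_s' -> nat) (co : 'I_t' -> nat) (D : 'M[F]_(s, t))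
    (L : 'M[F]_(s, s')) (M : 'M[F]_(s', t')) (Q : 'M[F]_(t', t)) :
    block_diag rn cn D -> block_diag rn ro L -> block_diag co cn Q ->
    (forall b, (#|[pred x | ro x == b]| <= q)%N) ->
    (forall b, (#|[pred y | co y == b]| <= q)%N) ->
    hss_tel q j (fun x => (ro x)./2) (fun y => (co y)./2) M ->
    hss_tel q j.+1 rn cn (D + L *m M *m Q).

Definition interval_tree (leaf depth s : nat) (rn : 'I_s -> nat) : Prop :=
  [/\ forall x y : 'I_s, (x <= y)%N -> (rn x <= rn y)%N,
      forall x, (rn x < 2 ^ depth)%N &
      forall b, (#|[pred x | rn x == b]| <= leaf)%N].

(* HSS form, of ranks at most [q], with respect to binary trees of intervals of
   the lists X and Y, whose leaves have at most [leaf] elements. *)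
Definition is_hss1d (leaf q : nat) (X Y : seq pt) (M : lmx) : Prop :=
  exists (depth : nat) (rn : 'I_(size X) -> nat) (cn : 'I_(size Y) -> nat),
    [/\ interval_tree leaf depth rn, interval_tree leaf depth cn &
        hss_tel q depth rn cn (mx X Y M)].

Definition hss_rank (leaf : nat) (delta : F) (X Y : seq pt) (q : nat)
  (M : lmx) : Prop :=
  exists M', is_hss1d leaf q X Y M' /\ close delta X Y M M'.

(* Compression to tolerance [delta]: to HSS1D form, to low rank by randomized
   interpolative decomposition (for one outcome of its random choices), and
   recompression of a low-rank factorization. *)
Record toolbox := Toolbox {
  tb_hss : F -> seq pt -> seq pt -> lmx -> lmx;
  tb_id  : F -> seq pt -> seq pt -> lmx -> lowrank;
  tb_rec : F -> seq pt -> seq pt -> lowrank -> lowrank }.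

Definition toolbox_ok (leaf c : nat) (tb : toolbox) : Prop :=
  forall (delta : F) (X Y : seq pt), 0 < delta ->
  [/\ forall M, close delta X Y M (tb_hss tb delta X Y M),
      forall M q, hss_rank leaf delta X Y q M ->
        is_hss1d leaf (c * maxn 1 q) X Y (tb_hss tb delta X Y M),
      forall M, close delta X Y M (lr_val (tb_id tb delta X Y M)),
      forall M q, num_rank delta X Y q M ->
        (lrk (tb_id tb delta X Y M) <= c * maxn 1 q)%N &
      forall A, close delta X Y (lr_val A) (lr_val (tb_rec tb delta X Y A)) /\
        (lrk (tb_rec tb delta X Y A) <= lrk A)%N].

End Matrices.

Arguments pt R : clear implicits.
Arguments lmx R F : clear implicits.
Arguments vec R F : clear implicits.
Arguments lowrank R F : clear implicits.
Arguments toolbox R F : clear implicits.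

Section Machine.
Context {R : realType} {F : numFieldType}.
Notation pt := (pt R).
Notation lmx := (lmx R F).
Notation vec := (vec R F).
Notation lowrank := (lowrank R F).

Inductive hss_kind :=
  HCompress | HInvert | HSum | HSplit | HMerge | HRecompress | HMatvec.

(* [m], [n], [p] are sizes and [q] is a rank. In [OH k X Y M], [M] is the
   operand of the HSS1D operation (the uncompressed result for a sum and a
   merge). *)
Inductive op :=
| OIndex (m : nat)
| OKernel (m n : nat)
| ODInv (X Y : seq pt) (M : lmx)
| ODMul (m n p : nat)
| ODMatvec (m n : nat)
| OVec (m : nat)
| OH (k : hss_kind) (X Y : seq pt) (M : lmx)
| OHssLr (m n q : nat)
| OLrMatvec (m n q : nat)
| OLrScale (m n q : nat)
| OId (m n q : nat)
| OLrToHss (m n q : nat)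
| OLrMul (m n p q : nat)
| OLrRec (m n q : nat).

(* Sizes and ranks are replaced by 1 when they are 0, so that no operation is
   required to be free. *)
Definition msize (s : seq nat) : nat := foldr maxn 1%N s.

Definition lr_bound (s : seq nat) (q : nat) : nat :=
  let m := msize s in let r := maxn 1 q in (m * r ^ 2 + r ^ 3)%N.

Definition op_bound (o : op) : nat :=
  match o with
  | OIndex m => msize [:: m]
  | OKernel m n => msize [:: m; n] ^ 2
  | ODInv X Y _ => msize [:: size X; size Y] ^ 3
  | ODMul m n p => msize [:: m; n; p] ^ 3
  | ODMatvec m n => msize [:: m; n] ^ 2
  | OVec m => msize [:: m]
  | OH _ X Y _ => msize [:: size X; size Y]
  | OHssLr m n q | OLrMatvec m n q | OLrScale m n q =>
      msize [:: m; n] * maxn 1 q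
  | OId m n q | OLrToHss m n q | OLrRec m n q => lr_bound [:: m; n] q
  | OLrMul m n p q => lr_bound [:: m; n; p] q
  end%N.

Inductive stored :=
| SDense (m n : nat)
| SLow (m n q : nat)
| SHss (X Y : seq pt) (M : lmx)
| SVec (m : nat).

Inductive event := EOp of op | EStore of stored.

(* The actual operation counts, and the actual number of entries used to store
   an HSS1D matrix. *)
Record machine := Machine {
  op_work : op -> nat;
  hss_entries : seq pt -> seq pt -> lmx -> nat }.

Definition entries (mc : machine) (s : stored) : nat :=
  match s with
  | SDense m n => m * n
  | SLow m n q => q * (m + n)
  | SHss X Y M => hss_entries mc X Y M
  | SVec m => m
  end%N.

Definition work (mc : machine) (tr : seq event) : nat :=
  (\sum_(e <- tr) (if e is EOp o then op_work mc o else 0))%N.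
Definition storage (mc : machine) (tr : seq event) : nat :=
  (\sum_(e <- tr) (if e is EStore s then entries mc s else 0))%N.

Definition cost_conventions (c : nat) (mc : machine) : Prop :=
  forall o, match o with
            | OH _ _ _ _ => True
            | _ => (op_work mc o <= c * op_bound o)%N : Prop
            end.

Definition hss_linear (c : nat) (mc : machine) (tr : seq event) : Prop :=
  List.Forall (fun e => match e with
    | EOp (OH k X Y M) =>
        (op_work mc (OH k X Y M) <= c * op_bound (OH k X Y M))%N : Prop
    | EStore (SHss X Y M) =>
        (hss_entries mc X Y M <= c * msize [:: size X; size Y])%N
    | _ => True end) tr.

Definition inverses_exist (tr : seq event) : Prop :=
  List.Forall (fun e => match e with
    | EOp (ODInv X Y M) | EOp (OH HInvert X Y M) =>
        size X = size Y /\ sqmx X Y M \in unitmx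
    | _ => True end) tr.

(* A program returns its result together with the list of the operations it
   performs and of the objects it stores. *)
Definition prog (A : Type) : Type := (A * seq event)%type.
Definition ret A (a : A) : prog A := (a, [::]).
Definition bind A B (m : prog A) (k : A -> prog B) : prog B :=
  let: (a, t) := m in let: (b, t') := k a in (b, t ++ t').
Definition perform A (o : op) (a : A) : prog A := (a, [:: EOp o]).
Definition keep A (s : stored) (a : A) : prog A := (a, [:: EStore s]).
Local Notation "x <- m ;; k" := (bind m (fun x => k))
  (at level 100, m at next level, right associativity).

Definition p_kernel (X Y : seq pt) (K : lmx) : prog lmx :=
  perform (OKernel (size X) (size Y)) K.
Definition p_inv (X Y : seq pt) (M : lmx) : prog lmx := perform (ODInv X Y M) (linv X Y M).
Definition p_mul (X Y Z : seq pt) (M P : lmx) : prog lmx :=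
  perform (ODMul (size X) (size Y) (size Z)) (lmul Y M P).
Definition p_app (X Y : seq pt) (M : lmx) (v : vec) : prog vec :=
  perform (ODMatvec (size X) (size Y)) (lapp Y M v).
Definition p_vadd (X : seq pt) (u v : vec) : prog vec :=
  perform (OVec (size X)) (fun p => u p + v p).
Definition p_vsub (X : seq pt) (u v : vec) : prog vec :=
  perform (OVec (size X)) (fun p => u p - v p).
Definition keep_dense (X Y : seq pt) (M : lmx) : prog lmx :=
  keep (SDense (size X) (size Y)) M.
Definition keep_vec (X : seq pt) (v : vec) : prog vec := keep (SVec (size X)) v.

Section CompressedPrimitives.
Context (tb : toolbox R F) (eps : F).

Definition h_compress (X Y : seq pt) (M : lmx) : prog lmx :=
  perform (OH HCompress X Y M) (tb_hss tb eps X Y M).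
Definition h_inv (X Y : seq pt) (M : lmx) : prog lmx :=
  perform (OH HInvert X Y M) (linv X Y M).
Definition h_add (X Y : seq pt) (M P : lmx) : prog lmx :=
  let S : lmx := fun p q => M p q + P p q in
  S' <- perform (OH HSum X Y S) S ;;
  perform (OH HRecompress X Y S') (tb_hss tb eps X Y S').
Definition h_app (X Y : seq pt) (M : lmx) (v : vec) : prog vec :=
  perform (OH HMatvec X Y M) (lapp Y M v).
(* The diagonal sub-blocks of [M] on [X1] and [X2], where X is the disjoint
   union of X1 and X2. *)
Definition h_split (X X1 X2 : seq pt) (M : lmx) : prog (lmx * lmx) :=
  perform (OH HSplit X X M)
    ((fun p q => if (p \in X1) && (q \in X1) then M p q else 0) : lmx,
     (fun p q => if (p \in X2) && (q \in X2) then M p q else 0) : lmx).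
(* The block-diagonal matrix with blocks [M1] and [M2], both extended by 0. *)
Definition h_merge (X : seq pt) (M1 M2 : lmx) : prog lmx :=
  let M : lmx := fun p q => M1 p q + M2 p q in perform (OH HMerge X X M) M.

Definition p_id (delta : F) (X Y : seq pt) (M : lmx) : prog lowrank :=
  let A := tb_id tb delta X Y M in
  perform (OId (size X) (size Y) (lrk A)) A.
Definition p_lrec (X Y : seq pt) (A : lowrank) : prog lowrank :=
  perform (OLrRec (size X) (size Y) (lrk A)) (tb_rec tb eps X Y A).
Definition p_hl (X Y Z : seq pt) (H : lmx) (A : lowrank) : prog lowrank :=
  perform (OHssLr (maxn (size X) (size Y)) (size Z) (lrk A)) (lr_mull Y H A).
Definition p_lh (X Y Z : seq pt) (A : lowrank) (H : lmx) : prog lowrank :=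
  perform (OHssLr (maxn (size X) (size Y)) (size Z) (lrk A)) (lr_mulr Y A H).
Definition p_ll (X Y Z : seq pt) (A B : lowrank) : prog lowrank :=
  perform (OLrMul (size X) (size Y) (size Z) (maxn (lrk A) (lrk B)))
          (lr_mul Y A B).
Definition p_lopp (X Y : seq pt) (A : lowrank) : prog lowrank :=
  perform (OLrScale (size X) (size Y) (lrk A)) (lr_opp A).
Definition p_ltoh (X Y : seq pt) (A : lowrank) : prog lmx :=
  perform (OLrToHss (size X) (size Y) (lrk A)) (lr_val A).
Definition p_lapp (X Y : seq pt) (A : lowrank) (v : vec) : prog vec :=
  perform (OLrMatvec (size X) (size Y) (lrk A)) (lapp Y (lr_val A) v).
Definition keep_low (X Y : seq pt) (A : lowrank) : prog lowrank :=
  keep (SLow (size X) (size Y) (lrk A)) A.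
Definition keep_hss (X Y : seq pt) (M : lmx) : prog lmx := keep (SHss X Y M) M.

End CompressedPrimitives.
End Machine.

Arguments op R F : clear implicits.
Arguments event R F : clear implicits.
Arguments machine R F : clear implicits.
Arguments prog R F A : clear implicits.
Notation "x <- m ;; k" := (bind m (fun x => k))
  (at level 100, m at next level, right associativity).

Section Setting.
Context {R : realType} {F : numFieldType}.
Notation pt := (pt R).
Notation lmx := (lmx R F).

Record box := Box { xlo : R; xhi : R; ylo : R; yhi : R }.

Definition in_box (B : box) (p : pt) : bool :=
  (xlo B <= p.1 < xhi B) && (ylo B <= p.2 < yhi B).

(* Bisection of a box, across the x axis if [ax] and across the y axis
   otherwise; [up] selects the upper half. *)
Definition half_box (ax up : bool) (B : box) : box :=
  let xm := (xlo B + xhi B) / 2 in let ym := (ylo B + yhi B) / 2 in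
  if ax then (if up then Box xm (xhi B) (ylo B) (yhi B)
              else Box (xlo B) xm (ylo B) (yhi B))
  else (if up then Box (xlo B) (xhi B) ym (yhi B)
        else Box (xlo B) (xhi B) (ylo B) ym).

(* The boxes of level l are numbered by j < 2 ^ l, and the children of (l, j)
   are (l + 1, 2 j) and (l + 1, 2 j + 1). The system matrix A is
   [mx (grid P) (grid P) (ker P)], and A(I,J) is [mx I J (ker P)]. *)
Record problem := Problem {
  depth : nat;
  gx : nat; gy : nat;
  origin : pt;
  hx : R; hy : R;
  ker : lmx;
  rect : box;
  cut : nat -> nat -> bool;
  sk : nat -> nat -> seq pt;
  rs : nat -> nat -> seq pt;
  prx : nat -> nat -> seq pt }.

Definition npts (P : problem) : nat := (gx P * gy P)%N.

Definition grid (P : problem) : seq pt :=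
  [seq ((origin P).1 + a%:R * hx P, (origin P).2 + b%:R * hy P)
     | a <- iota 0 (gx P), b <- iota 0 (gy P)].

Fixpoint tbox (P : problem) (l j : nat) : box :=
  if l is l'.+1 then half_box (cut P l' j./2) (odd j) (tbox P l' j./2)
  else rect P.

Definition box_pts (P : problem) (l j : nat) : seq pt :=
  [seq p <- grid P | in_box (tbox P l j) p].

Definition idx (P : problem) (l j : nat) : seq pt :=
  if (l < depth P)%N then sk P l.+1 j.*2 ++ sk P l.+1 j.*2.+1
  else box_pts P l j.

(* The index set of a box, skeleton first. *)
Definition idx' (P : problem) (l j : nat) : seq pt := sk P l j ++ rs P l j.

Definition is_box (P : problem) (l j : nat) : bool :=
  (l <= depth P)%N && (j < 2 ^ l)%N.

Definition nlev (P : problem) (l : nat) : R := (npts P)%:R / 2 ^+ l.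

Definition log2 (x : R) : R := ln x / ln 2.

Definition setting (nmax : nat) (P : problem) : Prop :=
  [/\ [/\ npts P = (nmax * 2 ^ depth P)%N, 0 < hx P & 0 < hy P],
      all (in_box (rect P)) (grid P),
      forall l j, is_box P l j -> (size (box_pts P l j))%:R <= nlev P l,
      forall l j, is_box P l j -> perm_eq (idx' P l j) (idx P l j) &
      forall l j, is_box P l j -> (0 < l)%N ->
        uniq (prx P l j) /\ size (prx P l j) = size (sk P l j)].

Definition near_boundary (P : problem) (w : nat) (B : box) (p : pt) : bool :=
  [|| p.1 - xlo B <= w%:R * hx P, xhi B - p.1 <= w%:R * hx P,
      p.2 - ylo B <= w%:R * hy P | yhi B - p.2 <= w%:R * hy P].

Definition just_outside (P : problem) (w : nat) (B : box) (p : pt) : bool :=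
  [&& ~~ in_box B p,
      xlo B - w%:R * hx P <= p.1 <= xhi B + w%:R * hx P &
      ylo B - w%:R * hy P <= p.2 <= yhi B + w%:R * hy P].

Definition skeleton_size_scaling (C : R) (P : problem) : Prop :=
  forall l j, is_box P l j -> (size (sk P l j))%:R <= C * nlev P l `^ (1 / 2).

(* The columns A(., p) and the rows A(p, .) over the points
   outside of a box are reproduced, for p in the box, by densities on the proxy
   points. *)
Definition localization (eps : F) (w : nat) (P : problem) : Prop :=
  forall l j, is_box P l j -> (0 < l)%N ->
  all (just_outside P w (tbox P l j)) (prx P l j) /\
  forall y, y \in grid P -> ~~ in_box (tbox P l j) y ->
    (exists rho : pt -> F, forall p, p \in box_pts P l j ->
       `|ker P y p - \sum_(z <- prx P l j) rho z * ker P z p| <= eps) /\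
    (exists rho : pt -> F, forall p, p \in box_pts P l j ->
       `|ker P p y - \sum_(z <- prx P l j) ker P p z * rho z| <= eps).

Definition skeleton_structure (w : nat) (P : problem) : Prop :=
  forall l j, is_box P l j -> all (near_boundary P w (tbox P l j)) (sk P l j).

Definition corner (B : box) : pt := (xlo B, ylo B).
(* The translation that takes box (l, 0) to box (l, j). *)
Definition offset (P : problem) (l j : nat) : pt :=
  corner (tbox P l j) - corner (tbox P l 0).
Definition shift_box (t : pt) (B : box) : box :=
  Box (xlo B + t.1) (xhi B + t.1) (ylo B + t.2) (yhi B + t.2).

Definition translation_invariant (P : problem) : Prop :=
  (forall t p q : pt, ker P (p + t) (q + t) = ker P p q) /\
  forall l j, is_box P l j ->
    [/\ tbox P l j = shift_box (offset P l j) (tbox P l 0),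
        sk P l j = [seq p + offset P l j | p <- sk P l 0],
        rs P l j = [seq p + offset P l j | p <- rs P l 0] &
        (0 < l)%N -> prx P l j = [seq p + offset P l j | p <- prx P l 0]].

(* The boundary of a box by arc length, and the interface between its two
   children. *)
Definition boundary_curve (B : box) (t : R) : pt :=
  let W := xhi B - xlo B in let H := yhi B - ylo B in
  if t <= W then (xlo B + t, ylo B)
  else if t <= W + H then (xhi B, ylo B + (t - W))
  else if t <= W + H + W then (xhi B - (t - W - H), yhi B)
  else (xlo B, yhi B - (t - W - H - W)).
Definition perimeter (B : box) : R :=
  2 * ((xhi B - xlo B) + (yhi B - ylo B)).
Definition interface (ax : bool) (B : box) (t : R) : pt :=
  if ax then ((xlo B + xhi B) / 2, ylo B + t)
  else (xlo B + t, (ylo B + yhi B) / 2).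
Definition interface_length (ax : bool) (B : box) : R :=
  if ax then yhi B - ylo B else xhi B - xlo B.

(* X lies within w layers of the curve and is listed in the order of the
   curve. *)
Definition ordered_along (P : problem) (w : nat) (curve : R -> pt) (len : R)
  (X : seq pt) : Prop :=
  exists tau : pt -> R, sorted (fun p q => tau p <= tau q) X /\
    forall p, p \in X ->
      [/\ 0 <= tau p <= len,
          `|(curve (tau p)).1 - p.1| <= w%:R * hx P &
          `|(curve (tau p)).2 - p.2| <= w%:R * hy P].

Definition curve_ordered (wsk wprx : nat) (P : problem) (l j : nat) : Prop :=
  let B := tbox P l j in
  [/\ ordered_along P wsk (boundary_curve B) (perimeter B) (sk P l j),
      ordered_along P wsk (interface (cut P l j) B)
        (interface_length (cut P l j) B) (rs P l j) &
      (0 < l)%N ->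
      ordered_along P wprx (boundary_curve B) (perimeter B) (prx P l j)].

End Setting.

Arguments problem R F : clear implicits.

Section Algorithms.
Context {R : realType} {F : numFieldType}.
Notation pt := (pt R).
Notation lmx := (lmx R F).
Notation vec := (vec R F).
Notation lowrank := (lowrank R F).
Notation event := (event R F).
Notation prog := (@prog R F).

(* In mode TI the matrices are computed and stored for the boxes (l, 0) only,
   and the other boxes of level l use translates of them. *)
Variant mode := NTI | TI.
Definition computed (md : mode) (l : nat) : seq nat :=
  if md is TI then [:: 0%N] else iota 0 (2 ^ l).

Definition levels (a b : nat) (f : nat -> seq event) : seq event :=
  flatten [seq f l | l <- iota a (b - a)].

Definition index_events (P : problem R F) : seq event :=
  levels 0 (depth P).+1 (fun l =>
    [seq EOp (OIndex (size (idx P l j))) | j <- iota 0 (2 ^ l)]).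

Definition mergeF (sk1 sk2 : seq pt) (K E1 E2 : lmx) : lmx := fun p q =>
  if (p \in sk1) && (q \in sk1) then E1 p q
  else if (p \in sk2) && (q \in sk2) then E2 p q
  else K p q.

Definition merge_vec (sk1 : seq pt) (u1 u2 : vec) : vec :=
  fun p => if p \in sk1 then u1 p else u2 p.

Definition dense_interp (K : lmx) (Z S X : seq pt) : prog lmx :=
  KS <- p_kernel Z S K ;;
  KX <- p_kernel Z X K ;;
  KI <- p_inv Z S KS ;;
  T <- p_mul S Z X KI KX ;;
  keep_dense S X T.

Definition dense_tree_box (P : problem R F) (l j : nat) : prog (lmx * lmx) :=
  Tup <- dense_interp (ker P) (prx P l j) (sk P l j) (rs P l j) ;;
  Tdn <- dense_interp (ltrans (ker P)) (prx P l j) (sk P l j) (rs P l j) ;;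
  ret (Tup, Tdn).

Definition dense_tree_build (md : mode) (P : problem R F) : seq event :=
  index_events P ++
  levels 1 (depth P).+1 (fun l =>
    flatten [seq (dense_tree_box P l j).2 | j <- computed md l]).

Record dense_mats := DenseMats {
  dTup : lmx; dTdn : lmx; dFinv : lmx; dE : lmx }.

Definition shift_dense (t : pt) (m : dense_mats) : dense_mats :=
  DenseMats (lshift t (dTup m)) (lshift t (dTdn m))
            (lshift t (dFinv m)) (lshift t (dE m)).

Definition Rmat (S : seq pt) (Tup : lmx) : lmx :=
  fun p q => if q \in S then (p == q)%:R else Tup p q.
Definition Lmat (S : seq pt) (Tdn : lmx) : lmx :=
  fun p q => if p \in S then (p == q)%:R else Tdn q p.

(* The matrices of box (l, j), given F; the matrices T come from the tree
   build. At the root there is no T and no E. *)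
Definition dense_box (P : problem R F) (l j : nat) (Fm : lmx) :
    prog dense_mats :=
  let I := idx' P l j in let S := sk P l j in
  Fi <- p_inv I I Fm ;;
  Finv <- keep_dense I I Fi ;;
  if l == 0%N then ret (DenseMats (fun _ _ => 0) (fun _ _ => 0) Finv
                                  (fun _ _ => 0))
  else
    let: (Tup, Tdn) := (dense_tree_box P l j).1 in
    RF <- p_mul S I I (Rmat S Tup) Finv ;;
    RFL <- p_mul S I S RF (Lmat S Tdn) ;;
    E <- p_inv S S RFL ;;
    E' <- keep_dense S S E ;;
    ret (DenseMats Tup Tdn Finv E').

(* Processing of the subtree of height h below box (depth - h, j). *)
Fixpoint dense_inv (md : mode) (P : problem R F) (h j : nat) :
    prog dense_mats :=
  let l := (depth P - h)%N in
  if h is h'.+1 then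
    let S1 := sk P l.+1 j.*2 in let S2 := sk P l.+1 j.*2.+1 in
    m1 <- dense_inv md P h' j.*2 ;;
    m2 <- (if md is TI
           then ret (shift_dense (offset P l.+1 j.*2.+1 - offset P l.+1 j.*2) m1)
           else dense_inv md P h' j.*2.+1) ;;
    K12 <- p_kernel S1 S2 (ker P) ;;
    K21 <- p_kernel S2 S1 (ker P) ;;
    dense_box P l j (mergeF S1 S2 (ker P) (dE m1) (dE m2))
  else
    K <- p_kernel (idx' P l j) (idx' P l j) (ker P) ;;
    dense_box P l j K.

Definition dense_inverse_compression (md : mode) (P : problem R F) :
    seq event := (dense_inv md P (depth P) 0).2.

Definition dense_mats_of (md : mode) (P : problem R F) (l j : nat) :
    dense_mats :=
  if md is TI then shift_dense (offset P l j) (dense_inv md P (depth P - l) 0).1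
  else (dense_inv md P (depth P - l) j).1.

Record node_apply := NodeApply {
  ap_Finv : vec -> prog vec;
  ap_Tup : vec -> prog vec;
  ap_TdnT : vec -> prog vec;
  ap_E : vec -> prog vec }.

Section Apply.
Context (P : problem R F) (ap : nat -> nat -> node_apply) (f : vec).

(* The pair (u_i, u_i^up) of box (depth - h, j). *)
Fixpoint upward (h j : nat) : prog (vec * vec) :=
  let l := (depth P - h)%N in
  let I := idx' P l j in let S := sk P l j in
  u0 <- (if h is h'.+1 then
           u1 <- upward h' j.*2 ;;
           u2 <- upward h' j.*2.+1 ;;
           ret (merge_vec (sk P l.+1 j.*2) u1.2 u2.2)
         else ret f) ;;
  u <- keep_vec I u0 ;;
  if l == 0%N then ret (u, u)
  else
    v <- ap_Finv (ap l j) u ;;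
    t <- ap_Tup (ap l j) v ;;
    s <- p_vadd S v t ;;
    e <- ap_E (ap l j) s ;;
    e' <- keep_vec S e ;;
    ret (u, e').

Definition apply_L (l j : nat) (v : vec) : prog vec :=
  t <- ap_TdnT (ap l j) v ;;
  ret (merge_vec (sk P l j) v t).

Fixpoint downward (h j : nat) (phi : vec) : prog vec :=
  let l := (depth P - h)%N in
  let I := idx' P l j in
  let: (u, uup) := (upward h j).1 in
  x0 <- (if l == 0%N then ap_Finv (ap l j) u
         else
           Lu <- apply_L l j uup ;;
           a <- p_vsub I u Lu ;;
           e <- ap_E (ap l j) phi ;;
           Le <- apply_L l j e ;;
           b <- p_vadd I a Le ;;
           ap_Finv (ap l j) b) ;;
  x <- keep_vec I x0 ;;
  if h is h'.+1 then
    y1 <- downward h' j.*2 x ;;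
    y2 <- downward h' j.*2.+1 x ;;
    ret (merge_vec (box_pts P l.+1 j.*2) y1 y2)
  else ret x.

Definition apply_events : seq event :=
  (upward (depth P) 0).2 ++ (downward (depth P) 0 (fun _ => 0)).2.

End Apply.

Definition dense_node_apply (P : problem R F) (l j : nat) (m : dense_mats) :
    node_apply :=
  let I := idx' P l j in let S := sk P l j in let X := rs P l j in
  NodeApply (p_app I I (dFinv m)) (p_app S X (dTup m))
            (p_app X S (ltrans (dTdn m))) (p_app S S (dE m)).

Definition dense_apply (md : mode) (P : problem R F) (f : vec) : seq event :=
  apply_events P (fun l j => dense_node_apply P l j (dense_mats_of md P l j)) f.

Section Compressed.
Context (tb : toolbox R F) (eps : F).

Definition comp_interp (K : lmx) (Z S X : seq pt) : prog lowrank :=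
  HS <- h_compress tb eps Z S K ;;
  HI <- h_inv Z S HS ;;
  HX <- h_compress tb eps Z X K ;;
  A <- p_id tb (2 * eps) Z X HX ;;
  T <- p_hl S Z X HI A ;;
  keep_low S X T.

Definition comp_tree_box (P : problem R F) (l j : nat) :
    prog (lowrank * lowrank) :=
  Tup <- comp_interp (ker P) (prx P l j) (sk P l j) (rs P l j) ;;
  Tdn <- comp_interp (ltrans (ker P)) (prx P l j) (sk P l j) (rs P l j) ;;
  ret (Tup, Tdn).

(* Leaves are handled densely. *)
Definition comp_tree_build (md : mode) (P : problem R F) : seq event :=
  index_events P ++
  levels 1 (depth P).+1 (fun l =>
    flatten [seq (if (l < depth P)%N then (comp_tree_box P l j).2
                  else (dense_tree_box P l j).2) | j <- computed md l]).

(* [cFsr], [cFrs] are the off-diagonal blocks of F, [cG] is the inverse of its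
   residual diagonal block, and [cP] the inverse of the Schur complement. *)
Inductive comp_mats :=
| CLeaf of dense_mats
| CNode (cTup cTdn cFsr cFrs : lowrank) (cG cP cE : lmx).

Definition cE (m : comp_mats) : lmx :=
  match m with CLeaf d => dE d | CNode _ _ _ _ _ _ E => E end.

Definition shift_comp (t : pt) (m : comp_mats) : comp_mats :=
  match m with
  | CLeaf d => CLeaf (shift_dense t d)
  | CNode Tup Tdn B C G P E =>
      CNode (lr_shift t Tup) (lr_shift t Tdn) (lr_shift t B) (lr_shift t C)
            (lshift t G) (lshift t P) (lshift t E)
  end.

Definition off_diagonal (sk1 sk2 : seq pt) (K : lmx) : lmx := fun p q =>
  if (p \in sk1) && (q \in sk2) || (p \in sk2) && (q \in sk1) then K p q
  else 0.

(* The blocks (F^rs)^-1, (S^rs)^-1, F^{s<-r}, F^{r<-s} of a non-leaf box, with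
   S, X its skeleton and residual sets and S1, S2 the skeletons of its
   children. *)
Definition comp_Finv (K : lmx) (S X S1 S2 : seq pt) (E1 E2 : lmx) :
    prog (lmx * lmx * lowrank * lowrank) :=
  let Fm := mergeF S1 S2 K E1 E2 in
  D1 <- h_split S1 [seq p <- S1 | p \in S] [seq p <- S1 | p \in X] E1 ;;
  D2 <- h_split S2 [seq p <- S2 | p \in S] [seq p <- S2 | p \in X] E2 ;;
  Dsk <- h_merge S D1.1 D2.1 ;;
  Drs <- h_merge X D1.2 D2.2 ;;
  Osk <- h_compress tb eps S S (off_diagonal S1 S2 K) ;;
  Ors <- h_compress tb eps X X (off_diagonal S1 S2 K) ;;
  Fsk <- h_add tb eps S S Dsk Osk ;;
  Frr <- h_add tb eps X X Drs Ors ;;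
  G <- h_inv X X Frr ;;
  Fsr <- p_id tb eps S X Fm ;;
  Frs <- p_id tb eps X S Fm ;;
  GC <- p_hl X X S G Frs ;;
  BGC <- p_ll S X S Fsr GC ;;
  nBGC <- p_lopp S S BGC ;;
  Hc <- p_ltoh S S nBGC ;;
  Sc <- h_add tb eps S S Fsk Hc ;;
  Pm <- h_inv S S Sc ;;
  G' <- keep_hss X X G ;;
  Pm' <- keep_hss S S Pm ;;
  Fsr' <- keep_low S X Fsr ;;
  Frs' <- keep_low X S Frs ;;
  ret (G', Pm', Fsr', Frs').

(* E from phi^sk = Pm, phi^{r<-s} = - G C Pm, phi^{s<-r} = - Pm B G and
   phi^rs = G + G C Pm B G, where B = F^{s<-r} and C = F^{r<-s}. *)
Definition comp_E (S X : seq pt) (Tup Tdn B C : lowrank) (G Pm : lmx) :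
    prog lmx :=
  let TdnT := lr_trans Tdn in
  GC <- p_hl X X S G C ;;
  GCP <- p_lh X S S GC Pm ;;
  BG <- p_lh S X X B G ;;
  PBG <- p_hl S S X Pm BG ;;
  phi_rs <- p_lopp X S GCP ;;
  phi_sr <- p_lopp S X PBG ;;
  t1 <- p_ll S X S Tup phi_rs ;;
  t2 <- p_ll S X S phi_sr TdnT ;;
  TG <- p_lh S X X Tup G ;;
  t3 <- p_ll S X S TG TdnT ;;
  TGCP <- p_ll S X S Tup GCP ;;
  BGT <- p_ll S X S BG TdnT ;;
  t4 <- p_ll S S S TGCP BGT ;;
  Q <- p_lrec tb eps S S (lr_add t1 (lr_add t2 (lr_add t3 t4))) ;;
  HQ <- p_ltoh S S Q ;;
  Ei <- h_add tb eps S S Pm HQ ;;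
  E <- h_inv S S Ei ;;
  keep_hss S S E.

Definition comp_box (P : problem R F) (l j : nat) (E1 E2 : lmx) :
    prog comp_mats :=
  let S := sk P l j in let X := rs P l j in
  b <- comp_Finv (ker P) S X (sk P l.+1 j.*2) (sk P l.+1 j.*2.+1) E1 E2 ;;
  let: (G, Pm, B, C) := b in
  if l == 0%N then
    let lr0 := LR 0 (fun _ _ => 0) (fun _ _ => 0) in
    ret (CNode lr0 lr0 B C G Pm (fun _ _ => 0))
  else
    let: (Tup, Tdn) := (comp_tree_box P l j).1 in
    E <- comp_E S X Tup Tdn B C G Pm ;;
    ret (CNode Tup Tdn B C G Pm E).

Fixpoint comp_inv (md : mode) (P : problem R F) (h j : nat) :
    prog comp_mats :=
  let l := (depth P - h)%N in
  if h is h'.+1 then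
    m1 <- comp_inv md P h' j.*2 ;;
    m2 <- (if md is TI
           then ret (shift_comp (offset P l.+1 j.*2.+1 - offset P l.+1 j.*2) m1)
           else comp_inv md P h' j.*2.+1) ;;
    comp_box P l j (cE m1) (cE m2)
  else
    K <- p_kernel (idx' P l j) (idx' P l j) (ker P) ;;
    m <- dense_box P l j K ;;
    ret (CLeaf m).

Definition comp_inverse_compression (md : mode) (P : problem R F) :
    seq event := (comp_inv md P (depth P) 0).2.

Definition comp_mats_of (md : mode) (P : problem R F) (l j : nat) :
    comp_mats :=
  if md is TI then shift_comp (offset P l j) (comp_inv md P (depth P - l) 0).1
  else (comp_inv md P (depth P - l) j).1.

(* The matrix F of a non-leaf box, as seen by the compressed algorithm. *)
Definition comp_F (md : mode) (P : problem R F) (l j : nat) : lmx :=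
  mergeF (sk P l.+1 j.*2) (sk P l.+1 j.*2.+1) (ker P)
    (cE (comp_mats_of md P l.+1 j.*2)) (cE (comp_mats_of md P l.+1 j.*2.+1)).

(* F^-1 u from the block factorization of F. *)
Definition comp_apply_Finv (S X : seq pt) (B C : lowrank) (G Pm : lmx)
    (u : vec) : prog vec :=
  a <- h_app X X G u ;;
  b <- p_lapp S X B a ;;
  r <- p_vsub S u b ;;
  y <- h_app S S Pm r ;;
  c <- p_lapp X S C y ;;
  g <- h_app X X G c ;;
  z <- p_vsub X a g ;;
  ret (merge_vec S y z).

Definition comp_node_apply (P : problem R F) (l j : nat) (m : comp_mats) :
    node_apply :=
  let S := sk P l j in let X := rs P l j in
  match m with
  | CLeaf d => dense_node_apply P l j d
  | CNode Tup Tdn B C G Pm E =>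
      NodeApply (comp_apply_Finv S X B C G Pm) (p_lapp S X Tup)
                (p_lapp X S (lr_trans Tdn)) (h_app S S E)
  end.

Definition hss_apply (md : mode) (P : problem R F) (f : vec) : seq event :=
  apply_events P (fun l j => comp_node_apply P l j (comp_mats_of md P l j)) f.

Definition comp_events (md : mode) (P : problem R F) (f : vec) : seq event :=
  comp_tree_build md P ++ comp_inverse_compression md P ++ hss_apply md P f.

End Compressed.

Definition dense_events (md : mode) (P : problem R F) (f : vec) : seq event :=
  dense_tree_build md P ++ dense_inverse_compression md P ++ dense_apply md P f.

End Algorithms.

Section Hypotheses.
Context {R : realType} {F : numFieldType}.

(* The constants of the assumptions and of the cost conventions. *)
Record constants := Constants {
  C_sk : R;          (* skeleton size *)
  w_sk : nat;        (* layers containing the skeletons *)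
  w_prx : nat;       (* layers containing the proxy points *)
  C_rank : R;        (* HSS and low-rank ranks *)
  hss_leaf : nat;    (* leaf size of the HSS1D trees *)
  c_hss : nat;       (* HSS1D operations *)
  c_tool : nat;      (* ranks found by the compression *)
  c_cost : nat }.    (* other operations *)

(* One run: the problem, the right-hand side, the compression routines and the
   operation counts. *)
Record instance := Instance {
  pb : problem R F;
  rhs : vec R F;
  tools : toolbox R F;
  mach : machine R F }.

Definition log_rank (C : R) (P : problem R F) (l q : nat) : Prop :=
  q%:R <= C * log2 (nlev P l).

(* Only non-leaf boxes are compressed. The blocks of F and E are those of the
   compressed algorithm. The last clause is the linear cost of the HSS1D
   operations it performs. *)
Definition compressed_block_structure (cs : constants) (eps : F) (md : mode)
    (x : instance) : Prop :=
  let P := pb x in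
  let is_hss l X Y M := exists2 q, log_rank (C_rank cs) P l q &
                          hss_rank (hss_leaf cs) eps X Y q M in
  let is_low l X Y M := exists2 q, log_rank (C_rank cs) P l q &
                          num_rank eps X Y q M in
  (forall l j, (l < depth P)%N -> j \in computed md l ->
    let S := sk P l j in let X := rs P l j in let Z := prx P l j in
    let Fm := comp_F (tools x) eps md P l j in
    [/\ curve_ordered (w_sk cs) (w_prx cs) P l j,
        is_hss l S S Fm /\ is_hss l X X Fm,
        is_low l S X Fm /\ is_low l X S Fm &
        (0 < l)%N ->
        [/\ is_hss l S S (cE (comp_mats_of (tools x) eps md P l j)),
            is_hss l Z S (ker P) /\ is_hss l Z S (ltrans (ker P)) &
            is_low l Z X (ker P) /\ is_low l Z X (ltrans (ker P))]]) /\
  hss_linear (c_hss cs) (mach x) (comp_events (tools x) eps md P (rhs x)).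

Definition mode_ok (md : mode) (P : problem R F) : Prop :=
  if md is TI then translation_invariant P else True.

Definition common_hyp (cs : constants) (eps : F) (nmax : nat) (md : mode)
    (x : instance) : Prop :=
  [/\ setting nmax (pb x),
      mode_ok md (pb x),
      [/\ skeleton_size_scaling (C_sk cs) (pb x),
          localization eps (w_prx cs) (pb x) &
          skeleton_structure (w_sk cs) (pb x)] &
      cost_conventions (c_cost cs) (mach x)].

Definition dense_hyp (cs : constants) (eps : F) (nmax : nat) (md : mode)
    (x : instance) : Prop :=
  common_hyp cs eps nmax md x /\
  inverses_exist (dense_events md (pb x) (rhs x)).

Definition comp_hyp (cs : constants) (eps : F) (nmax : nat) (md : mode)
    (x : instance) : Prop :=
  [/\ common_hyp cs eps nmax md x,
      toolbox_ok (hss_leaf cs) (c_tool cs) (tools x),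
      compressed_block_structure cs eps md x &
      inverses_exist (comp_events (tools x) eps md (pb x) (rhs x))].

(* [cost x = O(g(N))] as N goes to infinity, uniformly over all instances that
   satisfy [H]. *)
Definition isO (H : instance -> Prop) (cost : instance -> nat) (g : R -> R) :
    Prop :=
  exists (C : R) (N0 : nat), forall x, H x -> (N0 <= npts (pb x))%N ->
    (cost x)%:R <= C * g (npts (pb x))%:R.

End Hypotheses.

Arguments constants R : clear implicits.
Arguments instance R F : clear implicits.

(* Main.v *)
Require Import Defs.
From mathcomp Require Import all_boot all_order all_algebra archimedean.
From mathcomp Require Import boolp reals exp.
From mathcomp Require Import zify ring lra.
From Stdlib Require List.

(* A box at height k above the leaves carries O(2^(k/2)) indices, because its
   index set is made of the skeletons of its children, and the ranks of its
   blocks are O(k + 1). Each algorithm performs boundedly many operations per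
   box, so its cost is a sum over the heights k <= d of a cost per box times the
   number of boxes treated, which is 2^(d-k), or 1 when only one box per level
   is treated. Since 2^(d-k) 2^(3k/2) = 2^d 2^(k/2), the cubic dense work is
   dominated by the root; the quadratic costs are the same on every level; and
   2^(d-k) 2^(k/2) (k+1)^2 sums to O(2^d), dominated by the leaves. *)

Set Implicit Arguments.
Unset Strict Implicit.
Unset Printing Implicit Defensive.
Import Order.TTheory GRing.Theory Num.Theory.
Local Open Scope ring_scope.

(** * Operations and storage per box *)

Section Traces.
Context {R : realType} {F : numFieldType}.
Local Notation event := (event R F).
Local Notation op := (op R F).
Local Notation stored := (@stored R F).
Local Notation machine := (machine R F).
Local Open Scope nat_scope.

(** The sizes recorded in a trace come from the index lists; matrix entries influence only the
    ranks, through [tb_id] and [tb_rec]. Events are therefore counted for arbitrary size and rank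
    bounds, apart from the numerical estimates. Two obstacles remain. The rank assumptions speak of
    [comp_F], which in mode TI is built from translated matrices, so the recursion must be shown to
    compress exactly this matrix. And linear HSS1D cost is granted only for the operations of the
    given run, not for the machine, so each run is compared event by event with a reference machine.
    Since index sets and vectors are handled for every box even in mode TI, kinds of events are kept
    apart: index computations store nothing, and vectors need linear rather than quadratic
    storage. *)

Lemma bind1 A B (m : prog R F A) (k : A -> prog R F B) :
  (bind m k).1 = (k m.1).1.
Proof. by case: m => a t /=; case: (k a). Qed.

Lemma bind2 A B (m : prog R F A) (k : A -> prog R F B) :
  (bind m k).2 = m.2 ++ (k m.1).2.
Proof. by case: m => a t /=; case: (k a). Qed.

Definition weight (w : event -> nat) (tr : seq event) : nat :=
  \sum_(e <- tr) w e.

Lemma weight_nil w : weight w [::] = 0.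
Proof. exact: big_nil. Qed.

Lemma weight_cat w t1 t2 : weight w (t1 ++ t2) = weight w t1 + weight w t2.
Proof. exact: big_cat. Qed.

Lemma weight_flatten w (ts : seq (seq event)) :
  weight w (flatten ts) = \sum_(t <- ts) weight w t.
Proof.
elim: ts => [|t ts IH] /=; first by rewrite big_nil weight_nil.
by rewrite weight_cat big_cons IH.
Qed.

Definition few (n : nat) (p : pred event) (tr : seq event) : bool :=
  all p tr && (size tr <= n).

Lemma few_weight n p tr w M :
  few n p tr -> (forall e, p e -> w e <= M) -> weight w tr <= n * M.
Proof.
move=> /andP[tr_p tr_n] w_M.
apply: (@leq_trans (size tr * M)); last by rewrite leq_mul2r tr_n orbT.
rewrite /weight; elim: tr tr_p {tr_n} => [|e tr IH] /=; first by rewrite big_nil.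
by move=> /andP[pe /IH]; rewrite big_cons mulSn; apply: leq_add; apply: w_M.
Qed.

Lemma few_cat n m p t1 t2 : few n p t1 -> few m p t2 -> few (n + m) p (t1 ++ t2).
Proof.
by rewrite /few all_cat size_cat => /andP[-> n1] /andP[-> n2]; rewrite leq_add.
Qed.

Lemma few_impl n m (p q : pred event) tr :
  subpred p q -> n <= m -> few n p tr -> few m q tr.
Proof. by move=> pq nm /andP[/(sub_all pq) qtr /leq_trans/(_ nm) ntr]; apply/andP. Qed.

(* [tr] consists of at most [n * cnt k] events of kind [p k] for each height
   [k <= h], in the form in which it is used. *)
Definition charged (p : nat -> pred event) (n h : nat) (cnt : nat -> nat)
    (tr : seq event) : Prop :=
  forall (w : event -> nat) (g : nat -> nat),
    (forall k e, p k e -> w e <= g k) ->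
    weight w tr <= n * \sum_(k < h.+1) cnt k * g k.

(** Counted inside a subtree of height [h] rather than in the whole tree, so that inductions over
    subtrees apply. *)
Definition box_count (md : mode) (h k : nat) : nat :=
  if md is TI then 1 else 2 ^ (h - k).

Lemma size_computed md d l : l <= d -> size (computed md l) = box_count md d (d - l).
Proof. by case: md => //= l_le_d; rewrite size_iota subKn. Qed.

Lemma charged_cat p n m h cnt t1 t2 :
  charged p n h cnt t1 -> charged p m h cnt t2 -> charged p (n + m) h cnt (t1 ++ t2).
Proof.
by move=> c1 c2 w g wg; rewrite weight_cat mulnDl leq_add ?(c1 _ _ wg) ?(c2 _ _ wg).
Qed.

Lemma charged_impl (p q : nat -> pred event) n h cnt tr :
  (forall k e, p k e -> q k e) -> charged p n h cnt tr -> charged q n h cnt tr.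
Proof. by move=> pq c w g wg; apply: c => k e /pq; apply: wg. Qed.

(** Bounds that translation invariance does not improve are proved once for both modes through this
    weakening. *)
Lemma charged_all_boxes p n md h tr :
  charged p n h (box_count md h) tr -> charged p n h (box_count NTI h) tr.
Proof.
move=> c w g wg; apply: leq_trans (c w g wg) _; rewrite leq_mul2l; apply/orP; right.
apply: leq_sum => k _; rewrite leq_mul2r.
by case: md {c} => /=; rewrite ?leqnn ?expn_gt0 ?orbT.
Qed.

Lemma charged0 p n md tr : few n (p 0) tr -> charged p n 0 (box_count md 0) tr.
Proof.
move=> ftr w g wg; rewrite big_ord_recl big_ord0 addn0.
have -> : box_count md 0 0 = 1 by case: md.
by rewrite mul1n; apply: few_weight ftr _; apply: wg.
Qed.

(** Induction step over the height: two subtrees double each count, [2 * 2^(h-k) = 2^(h+1-k)],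
    whereas in mode TI the second child is a translate and emits no events. The trace enters only by
    its weight, because the programs emit the events of the top box before or after those of the
    subtrees. *)
Lemma chargedS p n md h tr a b c :
  charged p n h (box_count md h) a ->
  (md = NTI -> charged p n h (box_count md h) b) -> few n (p h.+1) c ->
  (forall w, weight w tr =
     weight w a + (if md is TI then 0 else weight w b) + weight w c) ->
  charged p n h.+1 (box_count md h.+1) tr.
Proof.
move=> ca cb fc tot w g wg; rewrite tot big_ord_recr /= mulnDr.
have top1 : box_count md h.+1 h.+1 = 1 by case: (md) => //=; rewrite subnn.
apply: leq_add; last by rewrite top1 mul1n; apply: few_weight fc _; apply: wg.
have wa := ca w g wg; case: md wa cb {ca tot top1} => /= wa cb; last by rewrite addn0.
have wb := cb erefl w g wg; apply: leq_trans (leq_add wa wb) _.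
rewrite addnn -muln2 -mulnA leq_mul2l; apply/orP; right.
rewrite big_distrl /=; apply: leq_sum => k _.
rewrite subSn; last by rewrite -ltnS ltn_ord.
by rewrite expnS mulnC mulnA.
Qed.

Lemma charged_levels p n md d a (t : nat -> nat -> seq event) :
  (forall l j, a <= l <= d -> j \in computed md l -> few n (p (d - l)) (t l j)) ->
  charged p n d (box_count md d)
    (levels a d.+1 (fun l => flatten [seq t l j | j <- computed md l])).
Proof.
move=> ft w g wg; rewrite /levels weight_flatten big_map.
(* The levels before [a] are added back, and reversing the sum turns levels into heights. *)
apply: (@leq_trans (\sum_(0 <= l < d.+1)
                       n * (box_count md d (d - l) * g (d - l)))); last first.
  rewrite big_distrr /= big_nat_rev big_mkord; apply: leq_sum => k _ /=.
  by have -> : d - (0 + d.+1 - k.+1) = k by have := ltn_ord k; lia.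
case: (leqP a d.+1) => [a_le|]; last first.
  by move=> /ltnW; rewrite -subn_eq0 => /eqP ->; rewrite big_nil.
rewrite -/(index_iota a d.+1) [leqRHS](big_cat_nat _ a_le) //=.
apply: leq_trans _ (leq_addl _ _); rewrite !big_nat; apply: leq_sum => l l_in.
have {}l_in : a <= l <= d by rewrite -ltnS.
rewrite weight_flatten big_map -size_computed; last by case/andP: l_in.
rewrite mulnCA -sum1_size big_distrl /= big_seq [leqRHS]big_seq.
apply: leq_sum => j j_in.
by rewrite mul1n; apply: few_weight (ft _ _ l_in j_in) _; apply: wg.
Qed.

(** * Kinds of events and the cost of a single event *)

Definition op_dims (o : op) : seq nat :=
  match o with
  | OIndex m | OVec m => [:: m]
  | OKernel m n | ODMatvec m n => [:: m; n]
  | ODInv X Y _ | OH _ X Y _ => [:: size X; size Y]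
  | ODMul m n p | OLrMul m n p _ => [:: m; n; p]
  | OHssLr m n _ | OLrMatvec m n _ | OLrScale m n _ | OId m n _
  | OLrToHss m n _ | OLrRec m n _ => [:: m; n]
  end.

Definition op_rank (o : op) : nat :=
  match o with
  | OHssLr _ _ q | OLrMatvec _ _ q | OLrScale _ _ q | OId _ _ q
  | OLrToHss _ _ q | OLrMul _ _ _ q | OLrRec _ _ q => q
  | _ => 0
  end.

Definition stored_dims (x : stored) : seq nat :=
  match x with
  | SDense m n | SLow m n _ => [:: m; n]
  | SHss X Y _ => [:: size X; size Y]
  | SVec m => [:: m]
  end.

Definition stored_rank (x : stored) : nat := if x is SLow _ _ q then q else 0.

Definition fits (s r : nat) (e : event) : bool :=
  match e with
  | EOp o => all (fun m => m <= s) (op_dims o) && (op_rank o <= r)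
  | EStore x => all (fun m => m <= s) (stored_dims x) && (stored_rank x <= r)
  end.

(** A separate kind: these events occur for every box in both modes, and storing nothing they do not
    spoil the storage bounds of mode TI. *)
Definition index_event (e : event) : bool :=
  if e is EOp (OIndex _) then true else false.

Definition dense_event (e : event) : bool :=
  match e with
  | EOp (OIndex _ | OKernel _ _ | ODInv _ _ _ | ODMul _ _ _ | ODMatvec _ _ | OVec _)
  | EStore (SDense _ _ | SVec _) => true
  | _ => false
  end.

(** The events of the dense apply. Their work is quadratic, but they store vectors only; this
    separates the storage of mode TI from that of mode NTI. *)
Definition matvec_event (e : event) : bool :=
  match e with
  | EOp (ODMatvec _ _ | OVec _) | EStore (SVec _) => true
  | _ => false
  end.

Definition compressed_event (e : event) : bool :=
  match e with
  | EOp (OKernel _ _ | ODInv _ _ _ | ODMul _ _ _ | ODMatvec _ _)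
  | EStore (SDense _ _) => false
  | _ => true
  end.

Lemma index_dense e : index_event e -> dense_event e.
Proof. by case: e => [[]|]. Qed.

Lemma index_compressed e : index_event e -> compressed_event e.
Proof. by case: e => [[]|]. Qed.

Lemma matvec_dense e : matvec_event e -> dense_event e.
Proof. by case: e => [[]|[]]. Qed.

Lemma fits_rank s r r' e : r <= r' -> fits s r e -> fits s r' e.
Proof. by move=> rr'; case: e => x /= /andP[-> /leq_trans ->]. Qed.

Definition op_cost (mc : machine) (e : event) : nat :=
  if e is EOp o then op_work mc o else 0.
Definition stored_cost (mc : machine) (e : event) : nat :=
  if e is EStore x then entries mc x else 0.

Lemma msize_le s ms : 0 < s -> all (fun m => m <= s) ms -> msize ms <= s.
Proof. by move=> s0; elim: ms => //= m ms IH /andP[ms_m /IH]; rewrite geq_max ms_m. Qed.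

Lemma dims_cost mc c (o : op) s r : cost_conventions c mc ->
  0 < s -> fits s r (EOp o) ->
  match o with OH _ _ _ _ => True | _ => op_work mc o <= c * op_bound o end /\
  msize (op_dims o) <= s.
Proof. by move=> cc s0 /andP[fo _]; split; [exact: cc | exact: msize_le]. Qed.

Lemma leq_expn m s i n : m <= s -> 0 < s -> i <= n -> m ^ i <= s ^ n.
Proof.
move=> ms s0 i_n; apply: (@leq_trans (s ^ i)); last exact: leq_pexp2l.
by case: i {i_n} => // i; rewrite leq_exp2r.
Qed.

Lemma dense_cost mc c s r e : cost_conventions c mc -> 0 < s ->
  fits s r e && dense_event e -> op_cost mc e <= c * s ^ 3.
Proof.
move=> cc s0 /andP[]; case: e => // o /(dims_cost cc s0)[].
case: o => //= *; (apply: leq_trans; first by eassumption); apply: leq_mul => //.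
all: first [exact: (@leq_expn _ _ 1) | exact: (@leq_expn _ _ 2)
           | exact: (@leq_expn _ _ 3)].
Qed.

Lemma matvec_cost mc c s r e : cost_conventions c mc -> 0 < s ->
  fits s r e && matvec_event e -> op_cost mc e <= c * s ^ 2.
Proof.
move=> cc s0 /andP[]; case: e => // o /(dims_cost cc s0)[].
case: o => //= *; (apply: leq_trans; first by eassumption); apply: leq_mul => //.
all: first [exact: (@leq_expn _ _ 1) | exact: (@leq_expn _ _ 2)
           | exact: (@leq_expn _ _ 3)].
Qed.

Lemma index_entries mc s r e :
  fits s r e && index_event e -> stored_cost mc e = 0.
Proof. by case: e => // ?; rewrite andbF. Qed.

Lemma dense_entries mc s r e :
  fits s r e && dense_event e -> stored_cost mc e <= s ^ 2.
Proof.
by move=> /andP[]; case: e => // -[] //= *; nia.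
Qed.

Lemma matvec_entries mc s r e :
  fits s r e && matvec_event e -> stored_cost mc e <= s.
Proof. by move=> /andP[]; case: e => // -[] //= *; nia. Qed.

(* Every operation costs exactly its bound on this machine, so that a cost on a
   given machine is at most a constant multiple of the cost on this one. *)
Definition unit_machine : machine :=
  Machine (@op_bound R F) (fun X Y _ => msize [:: size X; size Y]).

Lemma unit_cost_conventions : cost_conventions 1 unit_machine.
Proof. by case=> * //=; rewrite mul1n. Qed.

(** With [x] the rank, replaced by 1 if it is 0, every bound is [m], [m x] or [m x^2 + x^3], and the
    last dominates because [x >= 1]. *)
Lemma compressed_cost s r e : 0 < s -> 0 < r ->
  fits s r e && compressed_event e ->
  op_cost unit_machine e <= s * r ^ 2 + r ^ 3.
Proof.
move=> s0 r0 /andP[]; case: e => // o fo.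
have [_ ms] := dims_cost unit_cost_conventions s0 fo.
have /andP[_ rk] := fo.
have : maxn 1 (op_rank o) <= r by rewrite geq_max r0.
move: ms.
set m := msize _ => ms; set x := maxn _ _ => xr.
have x0 : 0 < x by rewrite leq_max.
have quad : m * x ^ 2 + x ^ 3 <= s * r ^ 2 + r ^ 3.
  by apply: leq_add; [apply: leq_mul => // |]; rewrite leq_exp2r.
have lin : m * x <= s * r ^ 2 + r ^ 3.
  apply: leq_trans _ quad; apply: leq_trans _ (leq_addr _ _).
  by rewrite leq_mul2l leq_pmulr ?orbT.
have const : m <= s * r ^ 2 + r ^ 3 by apply: leq_trans _ lin; rewrite leq_pmulr.
by case: o @m @x ms xr x0 quad lin const {fo rk} => //=.
Qed.

Lemma compressed_entries s r e : 0 < s -> 0 < r ->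
  fits s r e && compressed_event e ->
  stored_cost unit_machine e <= 2 * (s * r).
Proof.
move=> s0 r0 /andP[]; case: e => // -[] //=.
- move=> m n q /andP[/and3P[ms ns _] qr] _; rewrite mulnC mulnA leq_mul // mul2n -addnn.
  exact: leq_add.
- move=> X Y _ /andP[dims _] _.
  apply: leq_trans (@msize_le s [:: size X; size Y] s0 dims) _.
  by rewrite mulnCA leq_pmulr // muln_gt0.
- move=> m /andP[/andP[ms _] _] _.
  by rewrite mulnCA (leq_trans ms) // leq_pmulr // muln_gt0.
Qed.

Lemma work_weight mc tr : work mc tr = weight (op_cost mc) tr.
Proof. by []. Qed.

Lemma storage_weight mc tr : storage mc tr = weight (stored_cost mc) tr.
Proof. by []. Qed.

Lemma hss_linear_cat c mc (t1 t2 : seq event) :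
  hss_linear c mc (t1 ++ t2) -> hss_linear c mc t1 /\ hss_linear c mc t2.
Proof. by move=> /List.Forall_app. Qed.

(** The constant [c'] serves the ordinary operations and [c] the HSS1D ones. The comparison runs
    along the trace, since [hss_linear] says nothing about operations outside it. *)
Lemma hss_linear_work c c' mc tr : cost_conventions c' mc ->
  hss_linear c mc tr -> work mc tr <= (c' + c) * work unit_machine tr.
Proof.
move=> cc; rewrite !work_weight /weight.
elim=> [|e {}tr he _ IH]; first by rewrite !big_nil.
rewrite !big_cons mulnDr; apply: leq_add IH.
case: e he => //= o; have := cc o; case: o => //= *.
all: (apply: leq_trans; first by eassumption).
all: by rewrite leq_mul2r ?leq_addr ?leq_addl orbT.
Qed.

Lemma hss_linear_storage c mc tr :
  hss_linear c mc tr -> storage mc tr <= (1 + c) * storage unit_machine tr.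
Proof.
rewrite !storage_weight /weight; elim=> [|e {}tr he _ IH]; first by rewrite !big_nil.
rewrite !big_cons mulnDr; apply: leq_add IH.
case: e he => //= -[] * //=; try exact: leq_pmull.
by (apply: leq_trans; first by eassumption); rewrite leq_mul2r leq_addl orbT.
Qed.

(** * Events charged to the boxes of a problem *)

Section Problem.
Context (P : problem R F).
Local Notation d := (depth P).

Definition sized (s : nat -> nat) : Prop := forall l j, is_box P l j ->
  [/\ size (idx P l j) <= s (d - l), size (idx' P l j) <= s (d - l) &
      0 < l -> size (prx P l j) <= s (d - l)].

Context (s : nat -> nat) (P_sized : sized s).

Lemma size_sk l j : is_box P l j -> size (sk P l j) <= s (d - l).
Proof.
move=> /P_sized[_ /(leq_trans _) h _]; apply: h; by rewrite size_cat leq_addr.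
Qed.

Lemma size_rs l j : is_box P l j -> size (rs P l j) <= s (d - l).
Proof.
move=> /P_sized[_ /(leq_trans _) h _]; apply: h; by rewrite size_cat leq_addl.
Qed.

(** The skeletons of the children make up the index set of the parent, so the blocks between them
    are charged at the height of the parent. *)
Lemma size_child_sk l j : is_box P l j -> l < d ->
  (size (sk P l.+1 j.*2) <= s (d - l)) && (size (sk P l.+1 j.*2.+1) <= s (d - l)).
Proof.
move=> /P_sized[]; rewrite /idx => + _ _ => /[swap] ->; rewrite size_cat => h.
by rewrite !(leq_trans _ h) ?leq_addr ?leq_addl.
Qed.

Lemma is_box_computed md l j : l <= d -> j \in computed md l -> is_box P l j.
Proof.
rewrite /is_box => ->; case: md => /=; first by rewrite mem_iota.
by rewrite inE => /eqP ->; rewrite expn_gt0.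
Qed.

Lemma index_events_charged (r : nat -> nat) :
  charged (fun k e => fits (s k) (r k) e && index_event e) 1 d (box_count NTI d)
    (index_events P).
Proof.
have -> : index_events P = levels 0 d.+1 (fun l => flatten
    [seq [:: EOp (OIndex (size (idx P l j)))] | j <- computed NTI l]).
  rewrite /index_events /levels; congr flatten.
  by apply: eq_map => l; rewrite flatten_map1.
apply: charged_levels => l j /= l_d j_in.
have [h _ _] := P_sized (is_box_computed (md := NTI) l_d j_in).
by rewrite /few /= h.
Qed.

Lemma dense_tree_box_few (r : nat) l j : is_box P l j -> 0 < l ->
  few 10 (fun e => fits (s (d - l)) r e && dense_event e) (dense_tree_box P l j).2.
Proof.
move=> bx l0; have [_ _ /(_ l0) hZ] := P_sized bx.
have hS := size_sk bx; have hX := size_rs bx.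
by rewrite /few /= hZ hS hX.
Qed.

Lemma dense_tree_build_charged md (r : nat -> nat) :
  exists t1 t2, [/\ dense_tree_build md P = t1 ++ t2,
    charged (fun k e => fits (s k) (r k) e && index_event e) 1 d (box_count NTI d) t1 &
    charged (fun k e => fits (s k) (r k) e && dense_event e) 10 d (box_count md d) t2].
Proof.
do 2!eexists; split; [by [] | exact: index_events_charged |].
apply: charged_levels => l j /andP[l0 l_d] j_in.
by apply: dense_tree_box_few => //; apply: is_box_computed j_in.
Qed.

Lemma dense_box_few (r : nat) l j Fm : is_box P l j ->
  few 6 (fun e => fits (s (d - l)) r e && dense_event e) (dense_box P l j Fm).2.
Proof.
move=> bx; have [_ hI _] := P_sized bx.
have hS := size_sk bx; have hX := size_rs bx.
by rewrite /dense_box; case: (l == 0); rewrite /few /= ?hI ?hS.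
Qed.

Lemma computed_child md h j : h < d -> j \in computed md (d - h.+1) ->
  [/\ (d - h.+1).+1 = d - h, j.*2 \in computed md (d - h) &
      md = NTI -> j.*2.+1 \in computed md (d - h)].
Proof.
move=> h_d j_in; have child : (d - h.+1).+1 = d - h by lia.
rewrite -child; split=> // [|md_NTI]; move: j_in; last first.
  by rewrite md_NTI /= !mem_iota expnS /=; lia.
by case: md => /=; rewrite ?inE ?mem_iota ?expnS /=; lia.
Qed.

(** Eight is the six events of [dense_box] plus two off-diagonal kernel blocks; a leaf has only one
    kernel block. *)
Lemma dense_inv_charged md (r : nat -> nat) h j : h <= d ->
  j \in computed md (d - h) ->
  charged (fun k e => fits (s k) (r k) e && dense_event e) 8 h (box_count md h)
    (dense_inv md P h j).2.
Proof.
elim: h j => [|h IH] j h_d j_in; have bx := is_box_computed (leq_subr _ _) j_in.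
  have [_ + _] := P_sized bx; rewrite subKn // => hI.
  have := dense_box_few (r 0) (ker P) bx; rewrite subKn // => hbox.
  rewrite /dense_inv -/(dense_inv _ _) bind2; apply: charged0.
  apply: (few_impl _ _ (few_cat (n := 1) _ hbox)) => //.
  by rewrite /few /= hI.
have l_d : d - h.+1 < d by lia.
have /andP[] := size_child_sk bx l_d; rewrite subKn // => hS1 hS2.
have [_ j1 j2] := computed_child h_d j_in.
rewrite /dense_inv -/(dense_inv _ _) 4!bind2.
set Fm := mergeF _ _ _ _ _; set K12 := p_kernel _ _ _; set K21 := p_kernel _ _ _.
have := dense_box_few (r h.+1) Fm bx; rewrite subKn // => hbox.
apply: (chargedS (IH _ (ltnW h_d) j1) (fun m => IH _ (ltnW h_d) (j2 m))
                 (few_cat (n := 2) (t1 := K12.2 ++ K21.2) _ hbox)) => [|w].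
- by rewrite /few /= hS1 hS2.
- by rewrite !weight_cat !addnA; case: (md) => //; rewrite weight_nil.
Qed.

(** * The upward and downward passes, for any operators of the boxes *)

Section Apply.
Context (ap : nat -> nat -> @node_apply R F) (f : vec R F) (q : nat -> pred event).
Context (q_vec : forall k m, m <= s k ->
  q k (EOp (OVec m)) && q k (EStore (SVec m))).
(** Eight covers the longest operator, the seven operations of [comp_apply_Finv]. *)
Context (q_ap : forall l j v, is_box P l j ->
  [/\ few 8 (q (d - l)) (ap_Finv (ap l j) v).2,
      few 8 (q (d - l)) (ap_Tup (ap l j) v).2,
      few 8 (q (d - l)) (ap_TdnT (ap l j) v).2 &
      few 8 (q (d - l)) (ap_E (ap l j) v).2]).

(** The share of a single box in the recursion, isolated so that it can be counted apart from the
    recursive calls; likewise [downward_step]. *)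
Definition upward_step l j u0 :=
  u <- keep_vec (idx' P l j) u0 ;;
  if l == 0 then ret (u, u)
  else
    v <- ap_Finv (ap l j) u ;;
    t <- ap_Tup (ap l j) v ;;
    s <- p_vadd (sk P l j) v t ;;
    e <- ap_E (ap l j) s ;;
    e' <- keep_vec (sk P l j) e ;;
    ret (u, e').

Lemma upwardS h j : upward P ap f h.+1 j =
  (u0 <- (u1 <- upward P ap f h j.*2 ;;
          u2 <- upward P ap f h j.*2.+1 ;;
          ret (merge_vec (sk P (d - h.+1).+1 j.*2) u1.2 u2.2)) ;;
   upward_step (d - h.+1) j u0).
Proof. by []. Qed.

Definition downward_step l j u uup phi :=
  if l == 0 then ap_Finv (ap l j) u
  else
    Lu <- apply_L P ap l j uup ;;
    a <- p_vsub (idx' P l j) u Lu ;;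
    e <- ap_E (ap l j) phi ;;
    Le <- apply_L P ap l j e ;;
    b <- p_vadd (idx' P l j) a Le ;;
    ap_Finv (ap l j) b.

Lemma downward0 j phi : downward P ap f 0 j phi =
  let: (u, uup) := (upward P ap f 0 j).1 in
  x0 <- downward_step (d - 0) j u uup phi ;;
  keep_vec (idx' P (d - 0) j) x0.
Proof. by []. Qed.

Lemma downwardS h j phi : downward P ap f h.+1 j phi =
  let: (u, uup) := (upward P ap f h.+1 j).1 in
  x0 <- downward_step (d - h.+1) j u uup phi ;;
  x <- keep_vec (idx' P (d - h.+1) j) x0 ;;
  y1 <- downward P ap f h j.*2 x ;;
  y2 <- downward P ap f h j.*2.+1 x ;;
  ret (merge_vec (box_pts P (d - h.+1).+1 j.*2) y1 y2).
Proof. by []. Qed.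

Lemma upward_step_few l j u : is_box P l j ->
  few 27 (q (d - l)) (upward_step l j u).2.
Proof.
move=> bx; have [_ /q_vec/andP[_ vI] _] := P_sized bx.
have /andP[oS vS] := q_vec (size_sk bx).
have Finv v : few 8 (q (d - l)) (ap_Finv (ap l j) v).2 by case: (q_ap v bx).
have Tup v : few 8 (q (d - l)) (ap_Tup (ap l j) v).2 by case: (q_ap v bx).
have E v : few 8 (q (d - l)) (ap_E (ap l j) v).2 by case: (q_ap v bx).
rewrite /upward_step bind2.
apply: (few_cat (n := 1) (m := 26)); first by rewrite /few /= vI.
case: (l == 0) => //; rewrite !bind2.
apply: (few_cat (n := 8) (m := 18)); first exact: Finv.
apply: (few_cat (n := 8) (m := 10)); first exact: Tup.
apply: (few_cat (n := 1) (m := 9)); first by rewrite /few /= oS.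
apply: (few_cat (n := 8) (m := 1)); first exact: E.
by rewrite /few /= vS.
Qed.

Lemma downward_step_few l j u uup phi : is_box P l j ->
  few 34 (q (d - l)) (downward_step l j u uup phi).2.
Proof.
move=> bx; have [_ /q_vec/andP[oI _] _] := P_sized bx.
have Finv v : few 8 (q (d - l)) (ap_Finv (ap l j) v).2 by case: (q_ap v bx).
have small v : few 8 (q (d - l)) (apply_L P ap l j v).2.
  by rewrite /apply_L bind2 cats0; have [] := q_ap v bx.
rewrite /downward_step; case: (l == 0); first exact: few_impl (Finv u).
rewrite 5!bind2.
apply: (few_cat (n := 8) (m := 26)) => //.
apply: (few_cat (n := 1) (m := 25)); first by rewrite /few /= oI.
apply: (few_cat (n := 8) (m := 17)); first by have [] := q_ap phi bx.
apply: (few_cat (n := 8) (m := 9)) => //.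
apply: (few_cat (n := 1) (m := 8)); first by rewrite /few /= oI.
exact: Finv.
Qed.

Lemma upward_charged h j : h <= d -> j < 2 ^ (d - h) ->
  charged q 27 h (box_count NTI h) (upward P ap f h j).2.
Proof.
elim: h j => [|h IH] j h_d j_lt.
  have bx : is_box P (d - 0) j by rewrite /is_box leq_subr.
  have := upward_step_few f bx; rewrite subKn // => hbox.
  have -> : upward P ap f 0 j = (u0 <- ret f ;; upward_step (d - 0) j u0) by [].
  by rewrite bind2; exact: charged0.
have j_in : j \in computed NTI (d - h.+1) by rewrite mem_iota.
have bx := is_box_computed (leq_subr _ _) j_in.
have [_ + /(_ erefl)] := computed_child h_d j_in.
rewrite !mem_iota => /andP[_ j1] /andP[_ j2].
rewrite upwardS bind2; set u := (bind _ _).1.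
have := upward_step_few u bx; rewrite subKn // => hbox.
apply: (chargedS (IH _ (ltnW h_d) j1) (fun _ => IH _ (ltnW h_d) j2) hbox) => w.
by rewrite weight_cat !bind2 cats0 weight_cat.
Qed.

(** The pass reads only the values computed by [upward]; the events of that evaluation are dropped
    there and counted once, in the upward pass. The constant is 34 for the step and 1 for the stored
    vector. *)
Lemma downward_charged h j phi : h <= d -> j < 2 ^ (d - h) ->
  charged q 35 h (box_count NTI h) (downward P ap f h j phi).2.
Proof.
elim: h j phi => [|h IH] j phi h_d j_lt.
  have bx : is_box P (d - 0) j by rewrite /is_box leq_subr.
  have [_ + _] := P_sized bx; rewrite subKn // => /q_vec/andP[_ vI].
  rewrite downward0; case: (upward P ap f 0 j).1 => u uup.
  have := downward_step_few u uup phi bx; rewrite subKn // => hbox.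
  rewrite bind2; apply: charged0; apply: (few_cat (n := 34) (m := 1)) hbox _.
  by rewrite /few /= vI.
have j_in : j \in computed NTI (d - h.+1) by rewrite mem_iota.
have bx := is_box_computed (leq_subr _ _) j_in.
have [_ + _] := P_sized bx; rewrite subKn // => /q_vec/andP[_ vI].
have [_ + /(_ erefl)] := computed_child h_d j_in.
rewrite !mem_iota => /andP[_ j1] /andP[_ j2].
rewrite downwardS; case: (upward P ap f h.+1 j).1 => u uup.
have := downward_step_few u uup phi bx; rewrite subKn // => hbox.
rewrite 4!bind2 cats0; set x := keep_vec _ _.
have hx : few 1 (q h.+1) x.2 by rewrite /few /= vI.
apply: (chargedS (IH _ _ (ltnW h_d) j1) (fun _ => IH _ _ (ltnW h_d) j2)
                 (few_cat hbox hx)) => w.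
by rewrite !weight_cat addnA addnC.
Qed.

Lemma apply_events_charged :
  charged q 62 d (box_count NTI d) (apply_events P ap f).
Proof.
by apply: (@charged_cat _ 27 35); [apply: upward_charged | apply: downward_charged];
  rewrite ?subnn.
Qed.

End Apply.

Lemma dense_apply_charged md f (r : nat -> nat) :
  charged (fun k e => fits (s k) (r k) e && matvec_event e) 62 d (box_count NTI d)
    (dense_apply md P f).
Proof.
apply: apply_events_charged => [k m /= -> // | l j v bx].
have [_ hI _] := P_sized bx; have hS := size_sk bx; have hX := size_rs bx.
by rewrite /few /= hI hS hX.
Qed.

(** * The compressed algorithms *)

Section Compressed.
Context (tb : toolbox R F) (eps : F) (r : nat -> nat).
Context (tb_rec_rank : forall X Y A, lrk (tb_rec tb eps X Y A) <= lrk A).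

(** What the counting needs from the rank assumptions: ranks actually returned, for the matrices the
    algorithm meets. The root has no interpolation matrices. *)
Definition ranked (md : mode) : Prop := forall l j,
  l < d -> j \in computed md l ->
  let S := sk P l j in let X := rs P l j in let Fm := comp_F tb eps md P l j in
  [/\ lrk (tb_id tb eps S X Fm) <= r (d - l), lrk (tb_id tb eps X S Fm) <= r (d - l) &
      0 < l -> lrk (comp_tree_box tb eps P l j).1.1 <= r (d - l) /\
               lrk (comp_tree_box tb eps P l j).1.2 <= r (d - l)].

(* The factor 4 comes from the sum of four low-rank terms in the formula for
   the inverse of E. *)
Definition compressed_kind (k : nat) (e : event) : bool :=
  fits (s k) (4 * r k) e && (if k == 0 then dense_event e else compressed_event e).

Lemma leq_rank4 q k : q <= r k -> q <= 4 * r k.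
Proof. by move=> qr; rewrite (leq_trans qr) // leq_pmull. Qed.

Lemma comp_tree_build_charged md : ranked md ->
  exists t1 t2, [/\ comp_tree_build tb eps md P = t1 ++ t2,
    charged (fun k e => fits (s k) (r k) e && index_event e) 1 d (box_count NTI d) t1 &
    charged compressed_kind 12 d (box_count md d) t2].
Proof.
move=> rk; do 2!eexists; split; [by [] | exact: index_events_charged |].
apply: charged_levels => l j /andP[l0 l_d] j_in; have bx := is_box_computed l_d j_in.
case: ltnP => [l_lt|d_le]; last first.
  have dl : d - l = 0 by apply/eqP; rewrite subn_eq0.
  apply: few_impl (dense_tree_box_few (4 * r (d - l)) bx l0) => // e.
  by rewrite /compressed_kind dl.
have [_ _ /(_ l0)[/= /leq_rank4 rup /leq_rank4 rdn]] := rk l j l_lt j_in.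
have [_ _ /(_ l0) hZ] := P_sized bx; have hS := size_sk bx; have hX := size_rs bx.
have dl : (d - l == 0) = false by apply/eqP; lia.
by rewrite /few /compressed_kind dl /= !geq_max hZ hS hX rup rdn.
Qed.

(** [comp_Finv] has 24 events and [comp_E] has 19. The matrices [E1] and [E2] are arbitrary here;
    [comp_inv_box] later identifies the merged matrix with [comp_F]. *)
Lemma comp_box_few l j E1 E2 : is_box P l j -> l < d ->
  let S := sk P l j in let X := rs P l j in
  let Fm := mergeF (sk P l.+1 j.*2) (sk P l.+1 j.*2.+1) (ker P) E1 E2 in
  lrk (tb_id tb eps S X Fm) <= r (d - l) ->
  lrk (tb_id tb eps X S Fm) <= r (d - l) ->
  (0 < l -> lrk (comp_tree_box tb eps P l j).1.1 <= r (d - l) /\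
            lrk (comp_tree_box tb eps P l j).1.2 <= r (d - l)) ->
  few 43 (compressed_kind (d - l)) (comp_box tb eps P l j E1 E2).2.
Proof.
move=> bx l_d S X Fm rB rC rT.
have hS : size S <= _ := size_sk bx; have hX : size X <= _ := size_rs bx.
have /andP[hS1 hS2] := size_child_sk bx l_d.
have dl : (d - l == 0) = false by apply/eqP; lia.
have rB4 := leq_rank4 rB; have rC4 := leq_rank4 rC.
rewrite /comp_box bind2; apply: (few_cat (n := 24) (m := 19)).
  rewrite /few /compressed_kind dl /= -/S -/X -/Fm.
  by rewrite ?geq_max hS1 hS2 hS hX rB4 rC4.
case E: (comp_Finv _ _ _ _ _ _ _ _ _).1 => [[[G Pm] B] C].
have [BE CE] : B = tb_id tb eps S X Fm /\ C = tb_id tb eps X S Fm by case: E.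
move: rB rC rB4 rC4; rewrite -BE -CE => rB rC rB4 rC4 {BE CE E}.
case: (posnP l) rT => [-> // | l0] /(_ isT).
case: (comp_tree_box _ _ _ _ _).1 => Tup Tdn /= [rup rdn].
have [rup4 rdn4] := (leq_rank4 rup, leq_rank4 rdn).
rewrite /few /compressed_kind dl /= -/S -/X.
rewrite ?geq_max hS hX rB4 rC4 rup4 rdn4 /=.
(* A low-rank product has the rank of its left factor: [t1], [t3], [t4] that of [Tup], and [t2] that
   of [B]. *)
have sum4 : lrk Tup + (lrk B + (lrk Tup + lrk Tup)) <= 4 * r (d - l) by lia.
by rewrite sum4 (leq_trans (tb_rec_rank _ _ _)).
Qed.

Lemma lshift0 (M : lmx R F) : Defs.lshift 0%R M = M.
Proof. by apply/funext => p; apply/funext => p'; rewrite /Defs.lshift !subr0. Qed.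

Lemma cE_shift t (m : @comp_mats R F) : cE (shift_comp t m) = Defs.lshift t (cE m).
Proof. by case: m. Qed.

Lemma comp_invS md h j : comp_inv tb eps md P h.+1 j =
  let l := d - h.+1 in
  (m1 <- comp_inv tb eps md P h j.*2 ;;
   m2 <- (if md is TI
          then ret (shift_comp (offset P l.+1 j.*2.+1 - offset P l.+1 j.*2)%R m1)
          else comp_inv tb eps md P h j.*2.+1) ;;
   comp_box tb eps P l j (cE m1) (cE m2)).
Proof. by []. Qed.

(** Links the recursion to [comp_F], of which the rank assumptions speak. In mode TI the recursion
    translates the first child to obtain the second, while [comp_F] translates box 0 of the level;
    these agree because [j = 0] and box 0 has offset 0. *)
Lemma comp_inv_box md h j : h < d -> j \in computed md (d - h.+1) ->
  exists E1 E2, let l := d - h.+1 in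
  [/\ mergeF (sk P l.+1 j.*2) (sk P l.+1 j.*2.+1) (ker P) E1 E2 =
      comp_F tb eps md P l j,
      (comp_inv tb eps md P h.+1 j).1 = (comp_box tb eps P l j E1 E2).1 &
      forall w, weight w (comp_inv tb eps md P h.+1 j).2 =
        weight w (comp_inv tb eps md P h j.*2).2 +
        (if md is TI then 0 else weight w (comp_inv tb eps md P h j.*2.+1).2) +
        weight w (comp_box tb eps P l j E1 E2).2].
Proof.
move=> h_d j_in; rewrite comp_invS 2!bind1 2!bind2.
set m1 := comp_inv _ _ _ _ h j.*2; set m2 := (X in comp_box _ _ _ _ _ _ (cE X.1)).
exists (cE m1.1), (cE m2.1); split=> [||w]; [|by []|]; last first.
  by rewrite !weight_cat addnA /m2; case: (md) => //; rewrite weight_nil.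
rewrite /comp_F /comp_mats_of /m2 /m1; have -> : d - (d - h.+1).+1 = h by lia.
case: md j_in @m1 @m2 => //=; rewrite inE => /eqP ->; rewrite !cE_shift.
by rewrite {3}/offset subrr lshift0 [offset _ _ 0.*2]subrr subr0.
Qed.

(** What the apply must know of stored matrices: the dense format occurs exactly at height 0, and
    elsewhere the ranks are bounded. Both survive translation, so in mode TI every box of a level
    inherits them. *)
Definition mats_ok (k : nat) (m : @comp_mats R F) : bool :=
  match m with
  | CLeaf _ => k == 0
  | CNode Tup Tdn B C _ _ _ =>
      [&& 0 < k, lrk Tup <= r k, lrk Tdn <= r k, lrk B <= r k & lrk C <= r k]
  end.

Lemma mats_ok_shift k t m : mats_ok k (shift_comp t m) = mats_ok k m.
Proof. by case: m. Qed.

Lemma comp_box_mats l j E1 E2 : l < d ->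
  let S := sk P l j in let X := rs P l j in
  let Fm := mergeF (sk P l.+1 j.*2) (sk P l.+1 j.*2.+1) (ker P) E1 E2 in
  lrk (tb_id tb eps S X Fm) <= r (d - l) ->
  lrk (tb_id tb eps X S Fm) <= r (d - l) ->
  (0 < l -> lrk (comp_tree_box tb eps P l j).1.1 <= r (d - l) /\
            lrk (comp_tree_box tb eps P l j).1.2 <= r (d - l)) ->
  mats_ok (d - l) (comp_box tb eps P l j E1 E2).1.
Proof.
move=> l_d S X Fm rB rC rT; rewrite /comp_box bind1.
case E: (comp_Finv _ _ _ _ _ _ _ _ _).1 => [[[G Pm] B] C].
have [-> ->] : B = tb_id tb eps S X Fm /\ C = tb_id tb eps X S Fm by case: E.
case: (posnP l) rT => [l0 _ | l0 /(_ isT)]; first by rewrite /= subn_gt0 l_d rB rC.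
case: (comp_tree_box _ _ _ _ _).1 => Tup Tdn /= [rup rdn].
by rewrite subn_gt0 l_d rup rdn rB rC.
Qed.

Lemma comp_inv_mats md h j : ranked md -> h <= d -> j \in computed md (d - h) ->
  mats_ok h (comp_inv tb eps md P h j).1.
Proof.
case: h => [|h] rk h_d j_in.
  by rewrite /= [dense_box _ _ _ _]surjective_pairing.
have [E1 [E2 [FE -> _]]] := comp_inv_box h_d j_in.
have l_d : d - h.+1 < d by lia.
have [rB rC rT] := rk _ _ l_d j_in.
have := comp_box_mats (j := j) (E1 := E1) (E2 := E2) l_d.
by rewrite FE => /(_ rB rC rT); rewrite subKn.
Qed.

Lemma comp_inv_charged md h j : ranked md -> h <= d -> j \in computed md (d - h) ->
  charged compressed_kind 43 h (box_count md h) (comp_inv tb eps md P h j).2.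
Proof.
move=> rk; elim: h j => [|h IH] j h_d j_in;
  have bx := is_box_computed (leq_subr _ _) j_in.
  have [_ + _] := P_sized bx; rewrite subKn // => hI.
  have := dense_box_few (4 * r 0) (ker P) bx; rewrite subKn // => hbox.
  have -> : comp_inv tb eps md P 0 j =
    (K <- p_kernel (idx' P (d - 0) j) (idx' P (d - 0) j) (ker P) ;;
     m <- dense_box P (d - 0) j K ;; ret (CLeaf m)) by [].
  rewrite 2!bind2 cats0; apply: charged0.
  apply: (few_impl _ _ (few_cat (n := 1) _ hbox)) => //.
  by rewrite /few /= hI.
have l_d : d - h.+1 < d by lia.
have [_ j1 j2] := computed_child h_d j_in.
have [E1 [E2 [FE _ tot]]] := comp_inv_box h_d j_in.
have [rB rC rT] := rk _ _ l_d j_in.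
have hbox := comp_box_few (E1 := E1) (E2 := E2) bx l_d.
rewrite FE subKn // in hbox rB rC rT; have {}hbox := hbox rB rC rT.
exact: (chargedS (IH _ (ltnW h_d) j1) (fun m => IH _ (ltnW h_d) (j2 m)) hbox tot).
Qed.

Lemma comp_mats_of_ok md l j : ranked md -> is_box P l j ->
  mats_ok (d - l) (comp_mats_of tb eps md P l j).
Proof.
move=> rk /andP[l_d j_lt]; rewrite /comp_mats_of.
case: md rk => rk; rewrite ?mats_ok_shift; apply: comp_inv_mats => //.
- exact: leq_subr.
- by rewrite mem_iota subKn.
- exact: leq_subr.
Qed.

Lemma hss_apply_charged md f : ranked md ->
  charged compressed_kind 62 d (box_count NTI d) (hss_apply tb eps md P f).
Proof.
move=> rk; apply: apply_events_charged => [k m /= ms | l j v bx].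
  by rewrite /compressed_kind /= ms; case: (k == 0).
have [_ hI _] := P_sized bx; have hS := size_sk bx; have hX := size_rs bx.
have := comp_mats_of_ok rk bx; case: (comp_mats_of _ _ _ _ _ _) => [m /= dl|].
  by rewrite /few /compressed_kind dl /= hI hS hX.
move=> Tup Tdn B C G Pm E /and5P[/gtn_eqF dl].
move=> /leq_rank4 h1 /leq_rank4 h2 /leq_rank4 h3 /leq_rank4 h4.
by rewrite /few /compressed_kind dl /= hS hX h1 h2 h3 h4.
Qed.

End Compressed.

End Problem.

End Traces.

(** * Sums over the heights *)

Section Sums.
Context {R : realType}.

(** Rational bounds suffice. The lower one yields the constant 4 of the geometric sum, as
    [4 + t <= 4 t]; the upper one makes [t / 2 <= 3/4] a contraction ratio. *)
Lemma sqrt2_bounds (t := Num.sqrt 2 : R) : [/\ t ^+ 2 = 2, 4 / 3 <= t & t <= 3 / 2].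
Proof.
have t2 : t ^+ 2 = 2 by rewrite sqr_sqrtr.
have t0 : 0 <= t by exact: sqrtr_ge0.
by split=> //; nra.
Qed.

Lemma sqrt2_ge1 k : 1 <= (Num.sqrt 2 : R) ^+ k.
Proof. by have [_ h _] := sqrt2_bounds; apply: exprn_ege1; lra. Qed.

Lemma sqrt2_sqr k : ((Num.sqrt 2 : R) ^+ k) ^+ 2 = 2 ^+ k.
Proof. by have [h _ _] := sqrt2_bounds; rewrite exprAC h. Qed.

Lemma powR_half_pow2 k : (2 ^+ k) `^ (1 / 2) = (Num.sqrt 2 : R) ^+ k.
Proof.
rewrite div1r powR12_sqrt ?exprn_ge0 // -sqrt2_sqr sqrtr_sqr ger0_norm //.
by rewrite exprn_ge0 ?sqrtr_ge0.
Qed.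

Lemma sum_sqrt2 d : \sum_(k < d.+1) (Num.sqrt 2 : R) ^+ k <= 4 * Num.sqrt 2 ^+ d.
Proof.
have [_ h _] := sqrt2_bounds; elim: d => [|d IH].
  by rewrite big_ord_recl big_ord0 expr0; lra.
rewrite big_ord_recr /=; apply: le_trans (lerD IH (lexx _)) _.
by rewrite exprS; have := sqrt2_ge1 d; nra.
Qed.

Lemma sum_pow2 d : \sum_(k < d.+1) (2 : R) ^+ k <= 2 * 2 ^+ d.
Proof.
elim: d => [|d IH]; first by rewrite big_ord_recl big_ord0 expr0; lra.
by rewrite big_ord_recr /= exprS; apply: le_trans (lerD IH (lexx _)) _; lra.
Qed.

Lemma lin_le_sqrt2 k : k.+1%:R <= 4 * (Num.sqrt 2 : R) ^+ k.
Proof.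
have [_ h _] := sqrt2_bounds; elim: k => [|k IH]; first by rewrite expr0; lra.
by rewrite -natr1 exprS; have := sqrt2_ge1 k; nra.
Qed.

(* The sum telescopes: with p(k) = 4 k^2 + 32 k + 112,
   p(k) - 3/4 p(k+1) = (k+1)^2. *)
Lemma sum_sqr_geometric d :
  \sum_(k < d) (k.+1%:R : R) ^+ 2 * (3 / 4) ^+ k =
  112 - (4 * d%:R ^+ 2 + 32 * d%:R + 112) * (3 / 4) ^+ d.
Proof.
elim: d => [|d IH]; first by rewrite big_ord0 !expr0; lra.
by rewrite big_ord_recr /= IH -[d.+1%:R]natr1 [_ ^+ d.+1]exprS; field.
Qed.

(** Since [sqrt 2 / 2 <= 3/4], the terms are at most [2^d (k+1)^2 (3/4)^k], and 112 is the sum of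
    the full series of [(k+1)^2 (3/4)^k]. *)
Lemma sum_levels_sqr d : \sum_(k < d.+1)
  2 ^+ (d - k) * ((Num.sqrt 2 : R) ^+ k * k.+1%:R ^+ 2) <= 112 * 2 ^+ d.
Proof.
have [_ h1 h2] := sqrt2_bounds.
apply: (@le_trans _ _ (\sum_(k < d.+1)
                          2 ^+ d * (k.+1%:R ^+ 2 * (3 / 4) ^+ k))); last first.
  rewrite -mulr_sumr mulrC ler_wpM2r ?exprn_ge0 // sum_sqr_geometric gerBl.
  by rewrite mulr_ge0 ?exprn_ge0 //; have := ler0n R d.+1; [nra | lra].
apply: ler_sum => k _; have k_d : (k <= d)%N by rewrite -ltnS.
rewrite -[X in 2 ^+ X * (_ ^+ 2 * _)](subnK k_d) exprD -[leRHS]mulrA.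
apply: ler_wpM2l; first exact: exprn_ge0.
rewrite mulrC [leRHS]mulrCA; apply: ler_wpM2l; first exact: exprn_ge0.
by rewrite -exprMn lerXn2r ?nnegrE ?sqrtr_ge0 //; lra.
Qed.

Lemma sum_levels_dense d : \sum_(k < d.+1)
  2 ^+ (d - k) * ((Num.sqrt 2 : R) ^+ k) ^+ 3 <= 4 * (2 ^+ d * Num.sqrt 2 ^+ d).
Proof.
rewrite mulrCA; apply: le_trans (_ : 2 ^+ d * \sum_(k < d.+1) (Num.sqrt 2) ^+ k <= _).
  rewrite mulr_sumr; apply: ler_sum => k _; have k_d : (k <= d)%N by rewrite -ltnS.
  by rewrite exprSr sqrt2_sqr mulrA -exprD subnK.
by rewrite ler_wpM2l ?exprn_ge0 // sum_sqrt2.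
Qed.

Lemma sum_levels_sqrt2_sqr d : \sum_(k < d.+1)
  2 ^+ (d - k) * ((Num.sqrt 2 : R) ^+ k) ^+ 2 = d.+1%:R * 2 ^+ d.
Proof.
transitivity (\sum_(k < d.+1) (2 : R) ^+ d).
  apply: eq_bigr => k _; have k_d : (k <= d)%N by rewrite -ltnS.
  by rewrite sqrt2_sqr -exprD subnK.
by rewrite sumr_const card_ord mulr_natl.
Qed.

Lemma sum_weighted_sqrt2 d i :
  \sum_(k < d.+1) (Num.sqrt 2 : R) ^+ k * k.+1%:R ^+ i <=
  4 * (d.+1%:R ^+ i * Num.sqrt 2 ^+ d).
Proof.
rewrite mulrCA.
apply: le_trans (_ : d.+1%:R ^+ i * \sum_(k < d.+1) Num.sqrt 2 ^+ k <= _).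
  rewrite mulr_sumr; apply: ler_sum => k _.
  by rewrite mulrC ler_wpM2r ?exprn_ge0 ?sqrtr_ge0 // lerXn2r ?nnegrE // ler_nat.
by rewrite ler_wpM2l ?exprn_ge0 // sum_sqrt2.
Qed.

(** * Bounds per box and their sums over the tree or over one box per level *)

Section Bounds.
Context (Bs Br : R) (Bs_ge1 : 1 <= Bs) (Br_ge1 : 1 <= Br).

Let Bs_ge0 : 0 <= Bs. Proof. exact: le_trans ler01 Bs_ge1. Qed.
Let Br_ge0 : 0 <= Br. Proof. exact: le_trans ler01 Br_ge1. Qed.

(** Truncation makes the bound a natural number, as the counting requires, and loses nothing when it
    is compared with sizes. *)
Definition size_bound (k : nat) : nat := Num.trunc (Bs * Num.sqrt 2 ^+ k).
Definition rank_bound (k : nat) : nat := Num.trunc (Br * k.+1%:R).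

Lemma size_bound_ge n k : n%:R <= Bs * Num.sqrt 2 ^+ k -> (n <= size_bound k)%N.
Proof. by move=> h; rewrite truncn_ge_nat // (le_trans _ h). Qed.

Lemma rank_bound_ge n k : n%:R <= Br * k.+1%:R -> (n <= rank_bound k)%N.
Proof. by move=> h; rewrite truncn_ge_nat // (le_trans _ h). Qed.

Lemma size_bound_gt0 k : (0 < size_bound k)%N.
Proof. by apply: size_bound_ge; apply: mulr_ege1 => //; apply: sqrt2_ge1. Qed.

Lemma rank_bound_gt0 k : (0 < rank_bound k)%N.
Proof. by apply: rank_bound_ge; apply: mulr_ege1 => //; rewrite ler1n. Qed.

Lemma size_bound_le k : (size_bound k)%:R <= Bs * Num.sqrt 2 ^+ k.
Proof. by rewrite truncn_le // mulr_ge0 ?exprn_ge0 ?sqrtr_ge0. Qed.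

Lemma rank_bound_le k : (rank_bound k)%:R <= Br * k.+1%:R.
Proof. by rewrite truncn_le // mulr_ge0. Qed.

(* The factor [size_bound 0 ^ 3] accounts for the leaves, handled densely. *)
Definition box_work (k : nat) : nat :=
  (size_bound 0 ^ 3 *
   (size_bound k * (4 * rank_bound k) ^ 2 + (4 * rank_bound k) ^ 3))%N.
Definition box_storage (k : nat) : nat :=
  (size_bound 0 ^ 3 * (2 * (size_bound k * (4 * rank_bound k))))%N.

(** The 16 is the square of the factor 4 on ranks. The 256 is its cube times 4, from
    [k + 1 <= 4 sqrt 2^k], which lowers the cubic rank term to the order of the other one. *)
Definition box_const : R := (size_bound 0 ^ 3)%:R * (16 * Bs * Br ^+ 2 + 256 * Br ^+ 3).

Lemma box_const_ge0 : 0 <= box_const.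
Proof. by rewrite mulr_ge0 // addr_ge0 // !mulr_ge0 ?exprn_ge0. Qed.

Lemma box_work_le k :
  (box_work k)%:R <= box_const * (Num.sqrt 2 ^+ k * k.+1%:R ^+ 2).
Proof.
rewrite /box_work natrM /box_const -[leRHS]mulrA ler_wpM2l // natrD natrM !natrX !natrM.
have le_s := size_bound_le k; have le_r := rank_bound_le k; have le_x := lin_le_sqrt2 k.
set t := Num.sqrt 2 ^+ k in le_s le_x *; set x := k.+1%:R in le_r le_x *.
have x0 : 0 <= x by []; have t0 : 0 <= t by rewrite exprn_ge0 ?sqrtr_ge0.
apply: (@le_trans _ _ (Bs * t * (4 * (Br * x)) ^+ 2 + (4 * (Br * x)) ^+ 3)).
  apply: lerD; last by rewrite lerXn2r ?nnegrE ?mulr_ge0 // ler_wpM2l.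
  by apply: ler_pM; rewrite ?exprn_ge0 ?lerXn2r ?nnegrE ?mulr_ge0 ?ler_wpM2l.
have -> : Bs * t * (4 * (Br * x)) ^+ 2 + (4 * (Br * x)) ^+ 3 =
  16 * Bs * Br ^+ 2 * (t * x ^+ 2) + 64 * Br ^+ 3 * (x * x ^+ 2) by ring.
rewrite [leRHS]mulrDl lerD2l.
have -> : 256 * Br ^+ 3 * (t * x ^+ 2) = 64 * Br ^+ 3 * (4 * t * x ^+ 2) by ring.
by rewrite ler_wpM2l ?mulr_ge0 ?exprn_ge0 // ler_wpM2r ?exprn_ge0.
Qed.

Lemma box_storage_le k :
  (box_storage k)%:R <=
  (size_bound 0 ^ 3)%:R * (8 * Bs * Br) * (Num.sqrt 2 ^+ k * k.+1%:R).
Proof.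
rewrite /box_storage natrM -[leRHS]mulrA ler_wpM2l // !natrM.
have -> : 8 * Bs * Br * (Num.sqrt 2 ^+ k * k.+1%:R) =
  2 * ((Bs * Num.sqrt 2 ^+ k) * (4 * (Br * k.+1%:R))) by ring.
by rewrite ler_wpM2l // ler_pM ?mulr_ge0 ?size_bound_le // ler_wpM2l ?rank_bound_le.
Qed.

Lemma box_storage_work k : (box_storage k <= 2 * box_work k)%N.
Proof.
rewrite /box_storage /box_work; have := rank_bound_gt0 k.
move: (size_bound k) (rank_bound k) (size_bound 0 ^ 3)%N => a b c b0.
rewrite mulnCA; apply: leq_mul => //; apply: leq_mul => //.
by apply: leq_trans _ (leq_addr _ _); rewrite leq_mul // leq_pmulr // muln_gt0.
Qed.

Lemma sum_box_work d :
  (\sum_(k < d.+1) 2 ^ (d - k) * box_work k)%:R <= box_const * 112 * 2 ^+ d.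
Proof.
rewrite natr_sum -[leRHS]mulrA; apply: le_trans (ler_wpM2l _ (sum_levels_sqr d)).
  rewrite mulr_sumr; apply: ler_sum => k _; rewrite natrM natrX [leRHS]mulrCA.
  by rewrite ler_wpM2l ?exprn_ge0 // box_work_le.
exact: box_const_ge0.
Qed.

(** Lets the vectors stored by the dense apply on all boxes reuse [sum_box_work] as their linear
    bound. *)
Lemma size_bound_box_work k : (size_bound k <= box_work k)%N.
Proof.
rewrite /box_work; have := rank_bound_gt0 k; have := size_bound_gt0 0.
move: (size_bound k) (rank_bound k) (size_bound 0) => a b c c0 b0.
apply: leq_trans (leq_pmull _ _); last by rewrite expn_gt0 c0.
by apply: leq_trans _ (leq_addr _ _); rewrite leq_pmulr // expn_gt0 muln_gt0 b0.
Qed.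

Lemma sum_box_work_chain d :
  (\sum_(k < d.+1) box_work k)%:R <=
  box_const * 4 * (d.+1%:R ^+ 2 * Num.sqrt 2 ^+ d).
Proof.
rewrite natr_sum -[leRHS]mulrA; apply: le_trans (ler_wpM2l _ (sum_weighted_sqrt2 d 2)).
  by rewrite mulr_sumr; apply: ler_sum => k _; apply: box_work_le.
exact: box_const_ge0.
Qed.

Lemma sum_box_storage_chain d :
  (\sum_(k < d.+1) box_storage k)%:R <=
  (size_bound 0 ^ 3)%:R * (8 * Bs * Br) * 4 * (d.+1%:R * Num.sqrt 2 ^+ d).
Proof.
rewrite natr_sum -[leRHS]mulrA; apply: le_trans (ler_wpM2l _ (sum_weighted_sqrt2 d 1)).
  by rewrite mulr_sumr; apply: ler_sum => k _; apply: box_storage_le.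
by rewrite !mulr_ge0.
Qed.

Lemma sum_size_cube d :
  (\sum_(k < d.+1) 2 ^ (d - k) * size_bound k ^ 3)%:R <=
  Bs ^+ 3 * 4 * (2 ^+ d * Num.sqrt 2 ^+ d).
Proof.
rewrite natr_sum -[leRHS]mulrA; apply: le_trans (ler_wpM2l _ (sum_levels_dense d)).
  rewrite mulr_sumr; apply: ler_sum => k _; rewrite natrM !natrX [leRHS]mulrCA -exprMn.
  rewrite ler_wpM2l ?exprn_ge0 // lerXn2r ?nnegrE ?size_bound_le //.
  by rewrite mulr_ge0 // exprn_ge0 // sqrtr_ge0.
exact: exprn_ge0.
Qed.

Lemma sum_size_sqr d :
  (\sum_(k < d.+1) 2 ^ (d - k) * size_bound k ^ 2)%:R <=
  Bs ^+ 2 * (d.+1%:R * 2 ^+ d).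
Proof.
rewrite natr_sum -sum_levels_sqrt2_sqr mulr_sumr; apply: ler_sum => k _.
rewrite natrM !natrX [leRHS]mulrCA -exprMn ler_wpM2l ?exprn_ge0 //.
rewrite lerXn2r ?nnegrE ?size_bound_le //.
by rewrite mulr_ge0 // exprn_ge0 // sqrtr_ge0.
Qed.

Lemma sum_size_sqr_chain d :
  (\sum_(k < d.+1) size_bound k ^ 2)%:R <= Bs ^+ 2 * 2 * 2 ^+ d.
Proof.
rewrite natr_sum -[leRHS]mulrA; apply: le_trans (ler_wpM2l _ (sum_pow2 d)).
  rewrite mulr_sumr; apply: ler_sum => k _; rewrite natrX -sqrt2_sqr -exprMn.
  rewrite lerXn2r ?nnegrE ?size_bound_le //.
  by rewrite mulr_ge0 // exprn_ge0 // sqrtr_ge0.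
exact: exprn_ge0.
Qed.

End Bounds.

(** * From the depth of the tree to the number of points *)

Section Growth.
Context (nmax d : nat) (nmax_gt0 : (0 < nmax)%N).
Let N : R := (nmax * 2 ^ d)%:R.

Lemma pow2_le_npts : 2 ^+ d <= N.
Proof. by rewrite /N -natrX ler_nat leq_pmull. Qed.

Lemma ln2_gt0 : 0 < ln 2 :> R.
Proof. by apply: ln_gt0; rewrite ltr1n. Qed.

Lemma log2_pow2 (c : R) : 0 < c -> log2 (c * 2 ^+ d) = log2 c + d%:R.
Proof.
move=> c0; rewrite /log2 lnM ?posrE ?exprn_gt0 // lnXn // -[ln 2 *+ d]mulr_natl.
by rewrite mulrDl mulfK // gt_eqF // ln2_gt0.
Qed.

Lemma log2_nat_ge0 n : 0 <= log2 (n%:R : R).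
Proof.
(* At 0 the logarithm takes the default value 0. *)
rewrite /log2 divr_ge0 ?(ltW ln2_gt0) //; case: n => [|n]; first by rewrite ln0.
by rewrite ln_ge0 // ler1n.
Qed.

(** [d + 1 <= 2 d] and [d <= log2 N]. Depth 0 must be excluded: with [nmax = 1] the right side
    vanishes. *)
Lemma depth_le_log2 : (0 < d)%N -> d.+1%:R <= 2 * log2 N.
Proof.
move=> d0; rewrite /N natrM natrX log2_pow2 ?ltr0n // -natr1.
have := log2_nat_ge0 nmax; have : 1 <= d%:R :> R by rewrite ler1n.
by move: (log2 _) => y; lra.
Qed.

Lemma sqrt2_le_npts : Num.sqrt 2 ^+ d <= N `^ (1 / 2).
Proof.
by rewrite -powR_half_pow2 ge0_ler_powR ?nnegrE ?exprn_ge0 ?pow2_le_npts // divr_ge0.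
Qed.

Lemma pow2_sqrt2_le_npts : 2 ^+ d * Num.sqrt 2 ^+ d <= N `^ (3 / 2).
Proof.
have N0 : 0 < N by rewrite ltr0n muln_gt0 nmax_gt0 expn_gt0.
have -> : (3 / 2 : R) = 1 + 1 / 2 by lra.
rewrite powRD; last by rewrite (gt_eqF N0) implybT.
rewrite (powRr1 (ltW N0)); apply: ler_pM; rewrite ?exprn_ge0 ?sqrtr_ge0 //.
  exact: pow2_le_npts.
exact: sqrt2_le_npts.
Qed.

End Growth.

End Sums.

(** * Rates *)

Section Instances.
Context {R : realType} {F : numFieldType}.

Lemma nlev_height nmax (P : problem R F) l : setting nmax P -> (l <= depth P)%N ->
  nlev P l = nmax%:R * 2 ^+ (depth P - l).
Proof.
move=> [[P_npts _ _] _ _ _ _] l_d.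
rewrite /nlev P_npts natrM natrX -{1}(subnK l_d) exprD mulrA mulfK //.
by rewrite expf_neq0 ?pnatr_eq0.
Qed.

(** The terms give positivity, the size of a leaf, and the skeletons of two children. The absolute
    value is there because [C] has no prescribed sign. *)
Definition size_const (C : R) (nmax : nat) : R :=
  1 + nmax%:R + 2 * `|C| * Num.sqrt nmax%:R.

Lemma size_const_ge1 C nmax : 1 <= size_const C nmax.
Proof. by rewrite /size_const -addrA lerDl addr_ge0 // !mulr_ge0 ?sqrtr_ge0. Qed.

Lemma setting_sized C nmax (P : problem R F) :
  setting nmax P -> skeleton_size_scaling C P ->
  sized P (size_bound (size_const C nmax)).
Proof.
move=> st sk_le; have [_ _ pts_le perm prx_sz] := st.
have sk_bound l j : is_box P l j ->
    (size (sk P l j))%:R <= `|C| * Num.sqrt nmax%:R * Num.sqrt 2 ^+ (depth P - l).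
  move=> bx; apply: le_trans (sk_le _ _ bx) _; have /andP[l_d _] := bx.
  rewrite (nlev_height st l_d) powRM // ?exprn_ge0 // powR_half_pow2.
  rewrite div1r powR12_sqrt // mulrA -mulrA -[leRHS]mulrA ler_wpM2r ?ler_norm //.
  by rewrite mulr_ge0 ?exprn_ge0 ?sqrtr_ge0.
have K0 : 0 <= `|C| * Num.sqrt nmax%:R by rewrite mulr_ge0 ?sqrtr_ge0.
have n0 : 0 <= nmax%:R :> R by [].
have idx_le l j : is_box P l j ->
    (size (idx P l j) <= size_bound (size_const C nmax) (depth P - l))%N.
  move=> bx; apply: size_bound_ge; rewrite /idx /size_const.
  have /andP[l_d j_lt] := bx; case: ltnP => [l_lt|d_l].
    have b1 : is_box P l.+1 j.*2 by rewrite /is_box l_lt expnS; lia.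
    have b2 : is_box P l.+1 j.*2.+1 by rewrite /is_box l_lt expnS; lia.
    rewrite size_cat natrD.
    apply: le_trans (lerD (sk_bound _ _ b1) (sk_bound _ _ b2)) _.
    have le_step : Num.sqrt 2 ^+ (depth P - l.+1) <= Num.sqrt 2 ^+ (depth P - l) :> R.
      rewrite -(subnSK l_lt) exprS ler_peMl ?exprn_ge0 ?sqrtr_ge0 //.
      by have [_ ? _] := @sqrt2_bounds R; lra.
    have K_le := ler_wpM2l K0 le_step; apply: le_trans (lerD K_le K_le) _.
    move: (_ ^+ _) (exprn_ge0 (depth P - l) (sqrtr_ge0 (2 : R))) => z z0.
    rewrite -subr_ge0 [X in 0 <= X](_ : _ = (1 + nmax%:R) * z); last by ring.
    by rewrite mulr_ge0 // addr_ge0.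
  have -> : (depth P - l = 0)%N by apply/eqP; rewrite subn_eq0.
  rewrite expr0 mulr1; apply: le_trans (pts_le _ _ bx) _.
  rewrite (nlev_height st l_d); have -> : (depth P - l = 0)%N by lia.
  by rewrite expr0 mulr1 -mulrA; move: K0 n0; lra.
move=> l j bx; split; first exact: idx_le.
  by rewrite (perm_size (perm _ _ bx)) idx_le.
move=> l0; have [_ ->] := prx_sz _ _ bx l0.
apply: leq_trans (idx_le _ _ bx); rewrite -(perm_size (perm _ _ bx)).
by rewrite size_cat leq_addr.
Qed.

(** From [c (1 + |C| (log2 nmax + k)) <= c (1 + |C| (log2 nmax + 1)) (k + 1)], where [c] is the loss
    of the compression routines. *)
Definition rank_const (C : R) (c nmax : nat) : R :=
  1 + c%:R * (1 + `|C| * (log2 nmax%:R + 1)).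

Lemma rank_const_ge1 C c nmax : 1 <= rank_const C c nmax.
Proof.
by rewrite lerDl mulr_ge0 // addr_ge0 // mulr_ge0 // addr_ge0 // log2_nat_ge0.
Qed.

Lemma log_rank_bound C c nmax (P : problem R F) l q : (0 < nmax)%N ->
  setting nmax P -> (l <= depth P)%N -> log_rank C P l q ->
  (c * maxn 1 q <= rank_bound (rank_const C c nmax) (depth P - l))%N.
Proof.
move=> n0 st l_d; rewrite /log_rank (nlev_height st l_d) log2_pow2 ?ltr0n // => q_le.
apply: rank_bound_ge; move: (depth P - l)%N q_le => k q_le; rewrite natrM /rank_const.
have L0 := log2_nat_ge0 (R := R) nmax; have C0 := normr_ge0 C.
have k0 := ler0n R k; have c0 := ler0n R c.
have {}q_le : q%:R <= `|C| * (log2 nmax%:R + k%:R).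
  by apply: le_trans q_le _; rewrite ler_wpM2r ?ler_norm ?addr_ge0.
have m_le : (maxn 1 q)%:R <= 1 + `|C| * (log2 nmax%:R + k%:R).
  have CL : 0 <= `|C| * (log2 nmax%:R + k%:R) by rewrite mulr_ge0 ?addr_ge0.
  rewrite /maxn; case: ifP => _; last by rewrite lerDl.
  by apply: le_trans q_le _; rewrite lerDr.
apply: le_trans (ler_wpM2l c0 m_le) _; rewrite -natr1.
move: (log2 _) (`|C|) (k%:R) (c%:R) L0 C0 k0 c0 {q_le m_le} => L D x y L0 D0 x0 y0.
rewrite mulrDl mul1r -mulrA.
apply: le_trans (_ : _ <= y * ((1 + D * (L + 1)) * (x + 1))) _.
  apply: ler_wpM2l => //; have := mulr_ge0 D0 L0; have := mulr_ge0 D0 x0.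
  by have := mulr_ge0 L0 x0 => Lx; have := mulr_ge0 D0 Lx; nra.
by rewrite lerDr addr_ge0.
Qed.

(** In the tree build the decomposition is applied to an HSS1D approximation within [eps] of the
    kernel block. A rank-[q] matrix within [eps] of the block is then within [2 * eps] of the
    approximation, so at that tolerance the rank bound carries over. *)
Lemma comp_hyp_ranked (cs : constants R) (eps : F) nmax md (x : instance R F) :
  0 < eps -> (0 < nmax)%N -> comp_hyp cs eps nmax md x ->
  ranked (pb x) (tools x) eps
    (rank_bound (rank_const (C_rank cs) (c_tool cs) nmax)) md.
Proof.
move=> eps0 n0 [[st _ _ _] tok [blocks _] _] l j l_d j_in.
have [_ _ [lowB lowC] low_tree] := blocks l j l_d j_in.
have id_rank X Y M q : log_rank (C_rank cs) (pb x) l q -> num_rank eps X Y q M ->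
    (lrk (tb_id (tools x) eps X Y M) <=
     rank_bound (rank_const (C_rank cs) (c_tool cs) nmax) (depth (pb x) - l))%N.
  move=> /(log_rank_bound (c_tool cs) n0 st (ltnW l_d)) q_le M_q.
  by apply: leq_trans q_le; have [_ _ _ + _] := tok eps X Y eps0; apply.
have tree_rank X Y M q : log_rank (C_rank cs) (pb x) l q -> num_rank eps X Y q M ->
    (lrk (tb_id (tools x) (2 * eps) X Y (tb_hss (tools x) eps X Y M)) <=
     rank_bound (rank_const (C_rank cs) (c_tool cs) nmax) (depth (pb x) - l))%N.
  move=> /(log_rank_bound (c_tool cs) n0 st (ltnW l_d)) q_le [A [A_q A_M]].
  have eps2 : 0 < 2 * eps by rewrite mulr_gt0.
  apply: leq_trans q_le; have [_ _ _ + _] := tok (2 * eps) X Y eps2; apply.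
  exists A; split=> // p p' pX pY; have [M_H _ _ _ _] := tok eps X Y eps0.
  rewrite mulr_natl mulr2n -(subrKA (M p p')) (le_trans (ler_normD _ _)) //.
  by apply: lerD; [rewrite distrC; apply: M_H | apply: A_M].
split; [by case: lowB => q; apply: id_rank | by case: lowC => q; apply: id_rank |].
move=> l0; have [_ _ [up dn]] := low_tree l0.
by split; [case: up | case: dn] => q; apply: tree_rank.
Qed.

End Instances.

(** * Asymptotic bounds for each algorithm *)

Section Rates.
Context {R : realType} {F : numFieldType} (eps : F) (nmax : nat) (cs : constants R).
Context (eps_gt0 : 0 < eps) (nmax_gt0 : (0 < nmax)%N).

(** The threshold [nmax + 1] on the number of points forces a positive depth, which the logarithmic
    rates need. *)
Lemma isO_depth (H : instance R F -> Prop) (cost : instance R F -> nat)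
    (g : R -> R) (b : nat -> R) (f : nat -> nat) (c : nat) (K K' : R) :
  (forall x, H x -> setting nmax (pb x)) ->
  0 <= K -> (forall d, (f d)%:R <= K * b d) ->
  (forall d, (0 < d)%N -> b d <= K' * g (nmax * 2 ^ d)%:R) ->
  (forall x, H x -> (cost x <= c * f (depth (pb x)))%N) ->
  isO H cost g.
Proof.
move=> H_st K0 f_le b_le cost_le; exists (c%:R * K * K'), nmax.+1 => x Hx N_ge.
have [[Nx _ _] _ _ _ _] := H_st x Hx.
have d0 : (0 < depth (pb x))%N.
  by rewrite lt0n; apply: contraTneq N_ge => d0; rewrite Nx d0 muln1 ltnn.
apply: le_trans (_ : (c * f (depth (pb x)))%:R <= _); first by rewrite ler_nat cost_le.
rewrite natrM -!mulrA ler_wpM2l // (le_trans (f_le _)) // ler_wpM2l // Nx.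
exact: b_le.
Qed.

Lemma dense_setting md x : dense_hyp cs eps nmax md x -> setting nmax (pb x).
Proof. by case=> -[]. Qed.

Lemma comp_setting md x : comp_hyp cs eps nmax md x -> setting nmax (pb x).
Proof. by case=> -[]. Qed.

Lemma linear_rate d : 2 ^+ d <= 1 * (nmax * 2 ^ d)%:R :> R.
Proof. by rewrite mul1r; apply: pow2_le_npts. Qed.

Lemma log_linear_rate d : (0 < d)%N ->
  d.+1%:R * 2 ^+ d <= 2 * ((nmax * 2 ^ d)%:R * log2 (nmax * 2 ^ d)%:R) :> R.
Proof.
move=> d0; rewrite mulrCA mulrC ler_pM ?exprn_ge0 ?pow2_le_npts //.
exact: depth_le_log2.
Qed.

Lemma sqrt_log_rate d i : (0 < d)%N ->
  d.+1%:R ^+ i * Num.sqrt 2 ^+ d <=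
  2 ^+ i * ((nmax * 2 ^ d)%:R `^ (1 / 2) * log2 (nmax * 2 ^ d)%:R ^+ i) :> R.
Proof.
move=> d0; rewrite mulrCA -exprMn mulrC.
rewrite ler_pM ?exprn_ge0 ?sqrtr_ge0 ?sqrt2_le_npts //.
have h := depth_le_log2 (R := R) nmax_gt0 d0.
by rewrite lerXn2r ?nnegrE // (le_trans _ h).
Qed.

Local Notation s := (size_bound (size_const (C_sk cs) nmax)).
Local Notation r := (rank_bound (rank_const (C_rank cs) (c_tool cs) nmax)).
Let s_ge1 := size_const_ge1 (C_sk cs) nmax.
Let r_ge1 := rank_const_ge1 (C_rank cs) (c_tool cs) nmax.
Let s_gt0 := size_bound_gt0 s_ge1.
Let r_gt0 := rank_bound_gt0 r_ge1.
Local Notation bwork := (box_work (size_const (C_sk cs) nmax)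
  (rank_const (C_rank cs) (c_tool cs) nmax)).
Local Notation bstorage := (box_storage (size_const (C_sk cs) nmax)
  (rank_const (C_rank cs) (c_tool cs) nmax)).

Lemma dense_sized md x : dense_hyp cs eps nmax md x -> sized (pb x) s.
Proof. by case=> -[st _ [sk_le _ _] _] _; apply: setting_sized. Qed.

Lemma comp_sized md x : comp_hyp cs eps nmax md x -> sized (pb x) s.
Proof. by case=> -[st _ [sk_le _ _] _] _ _ _; apply: setting_sized. Qed.

Lemma dense_cost_conventions md x :
  dense_hyp cs eps nmax md x -> cost_conventions (c_cost cs) (mach x).
Proof. by case=> -[]. Qed.

Lemma dense_work_cubic md (tr : instance R F -> seq (event R F)) n :
  (forall x, dense_hyp cs eps nmax md x -> charged
    (fun k e => fits (s k) (r k) e && dense_event e) n (depth (pb x))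
    (box_count NTI (depth (pb x))) (tr x)) ->
  isO (dense_hyp cs eps nmax md) (fun x => work (mach x) (tr x))
      (fun N => N `^ (3 / 2)).
Proof.
move=> ch; pose f d := (\sum_(k < d.+1) 2 ^ (d - k) * s k ^ 3)%N.
apply: (isO_depth (b := fun d => 2 ^+ d * Num.sqrt 2 ^+ d) (f := f)
         (c := (c_cost cs * n)%N) (K := size_const (C_sk cs) nmax ^+ 3 * 4) (K' := 1)).
- exact: dense_setting.
- by rewrite mulr_ge0 // exprn_ge0 // (le_trans ler01).
- by move=> d; apply: sum_size_cube.
- by move=> d _; rewrite mul1r; apply: pow2_sqrt2_le_npts.
move=> x hx; rewrite work_weight.
have := ch x hx _ (fun k => c_cost cs * s k ^ 3)%N
  (fun k e => dense_cost (r := r k) (dense_cost_conventions hx) (s_gt0 k)).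
move=> /leq_trans; apply; rewrite -mulnA mulnCA leq_mul2l; apply/orP; right.
by rewrite /f big_distrr /=; apply: eq_leq; apply: eq_bigr => k _; rewrite mulnCA.
Qed.

Lemma dense_tree_charged md x : dense_hyp cs eps nmax md x ->
  charged (fun k e => fits (s k) (r k) e && dense_event e) 11 (depth (pb x))
    (box_count NTI (depth (pb x))) (dense_tree_build md (pb x)).
Proof.
move=> hx; have [t1 [t2 [-> c1 c2]]] := dense_tree_build_charged (dense_sized hx) md r.
apply: (@charged_cat _ _ _ 1 10); last exact: charged_all_boxes c2.
by apply: charged_impl c1 => k e /andP[-> /index_dense ->].
Qed.

Lemma dense_compression_charged md x : dense_hyp cs eps nmax md x ->
  charged (fun k e => fits (s k) (r k) e && dense_event e) 8 (depth (pb x))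
    (box_count md (depth (pb x))) (dense_inverse_compression md (pb x)).
Proof.
move=> hx; apply: dense_inv_charged => //; first exact: dense_sized hx.
by rewrite subnn; case: (md).
Qed.

Lemma dense_tree_work md : isO (dense_hyp cs eps nmax md)
  (fun x => work (mach x) (dense_tree_build md (pb x))) (fun N => N `^ (3 / 2)).
Proof.
exact: dense_work_cubic (@dense_tree_charged md).
Qed.

Lemma dense_inv_work md : isO (dense_hyp cs eps nmax md)
  (fun x => work (mach x) (dense_inverse_compression md (pb x)))
  (fun N => N `^ (3 / 2)).
Proof.
apply: dense_work_cubic => x hx.
exact: charged_all_boxes (dense_compression_charged hx).
Qed.

Lemma dense_apply_work md : isO (dense_hyp cs eps nmax md)
  (fun x => work (mach x) (dense_apply md (pb x) (rhs x)))
  (fun N => N * log2 N).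
Proof.
pose f d := (\sum_(k < d.+1) 2 ^ (d - k) * s k ^ 2)%N.
apply: (isO_depth (b := fun d => d.+1%:R * 2 ^+ d) (f := f)
         (c := (c_cost cs * 62)%N) (K := size_const (C_sk cs) nmax ^+ 2) (K' := 2)).
- exact: dense_setting.
- by rewrite exprn_ge0 // (le_trans ler01).
- by move=> d; apply: sum_size_sqr.
- by move=> d d0; apply: log_linear_rate.
move=> x hx; rewrite work_weight.
have := dense_apply_charged (dense_sized hx) md (rhs x)
  (fun k e => matvec_cost (r := r k) (dense_cost_conventions hx) (s_gt0 k)).
move=> /leq_trans; apply; rewrite -mulnA mulnCA leq_mul2l; apply/orP; right.
by rewrite /f big_distrr /=; apply: eq_leq; apply: eq_bigr => k _; rewrite mulnCA.
Qed.

Lemma dense_storage_NTI : isO (dense_hyp cs eps nmax NTI)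
  (fun x => storage (mach x) (dense_events NTI (pb x) (rhs x)))
  (fun N => N * log2 N).
Proof.
pose f d := (\sum_(k < d.+1) 2 ^ (d - k) * s k ^ 2)%N.
apply: (isO_depth (b := fun d => d.+1%:R * 2 ^+ d) (f := f)
         (c := 81) (K := size_const (C_sk cs) nmax ^+ 2) (K' := 2)).
- exact: dense_setting.
- by rewrite exprn_ge0 // (le_trans ler01).
- by move=> d; apply: sum_size_sqr.
- by move=> d d0; apply: log_linear_rate.
move=> x hx; rewrite storage_weight.
have c3 : charged (fun k e => fits (s k) (r k) e && dense_event e) 62 (depth (pb x))
    (box_count NTI (depth (pb x))) (dense_apply NTI (pb x) (rhs x)).
  apply: (charged_impl _ (dense_apply_charged (dense_sized hx) NTI (rhs x) (r := r))).
  by move=> k e /andP[-> /matvec_dense ->].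
have c := charged_cat (dense_tree_charged hx)
  (charged_cat (dense_compression_charged hx) c3).
exact: c _ _ (fun k e => @dense_entries _ _ (mach x) (s k) (r k) e).
Qed.

(** Index events store nothing; one set of matrices per level gives a geometric sum of [s k ^ 2],
    dominated by the root; vectors live on all boxes but take only [s k] entries each. The factor 62
    of the vectors also covers the 10 and 8 of the matrices. *)
Lemma dense_storage_TI : isO (dense_hyp cs eps nmax TI)
  (fun x => storage (mach x) (dense_events TI (pb x) (rhs x))) (fun N => N).
Proof.
pose f d := (\sum_(k < d.+1) s k ^ 2 + \sum_(k < d.+1) 2 ^ (d - k) * bwork k)%N.
pose K1 := size_const (C_sk cs) nmax ^+ 2 * 2.
pose K2 := box_const (size_const (C_sk cs) nmax)
             (rank_const (C_rank cs) (c_tool cs) nmax) * 112.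
have s0 := le_trans ler01 s_ge1; have r0 := le_trans ler01 r_ge1.
apply: (isO_depth (b := fun d => 2 ^+ d) (f := f) (c := 62) (K := K1 + K2) (K' := 1)).
- exact: dense_setting.
- by apply: addr_ge0; [rewrite mulr_ge0 ?exprn_ge0 | rewrite mulr_ge0 ?box_const_ge0].
- by move=> d; rewrite natrD mulrDl lerD ?sum_size_sqr_chain ?sum_box_work.
- by move=> d _; apply: linear_rate.
move=> x hx; rewrite storage_weight; have P_sized := dense_sized hx.
have [t1 [t2 [E c1 c2]]] := dense_tree_build_charged P_sized TI r.
rewrite /dense_events E 3!weight_cat.
have w1 : (weight (stored_cost (mach x)) t1 <= 0)%N.
  apply: leq_trans (c1 _ (fun=> 0%N) _) _; first by move=> k e /index_entries ->.
  by rewrite mul1n; apply: eq_leq; apply: big1 => k _; rewrite muln0.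
have w2 := c2 _ _ (fun k e => @dense_entries _ _ (mach x) (s k) (r k) e).
have w3 := dense_compression_charged hx
  (fun k e => @dense_entries _ _ (mach x) (s k) (r k) e).
have w4 := dense_apply_charged P_sized TI (rhs x)
  (fun k e => @matvec_entries _ _ (mach x) (s k) (r k) e).
have chain : (\sum_(k < (depth (pb x)).+1) box_count TI (depth (pb x)) k * s k ^ 2 =
              \sum_(k < (depth (pb x)).+1) s k ^ 2)%N.
  by apply: eq_bigr => k _; rewrite mul1n.
have vecs : (\sum_(k < (depth (pb x)).+1) box_count NTI (depth (pb x)) k * s k <=
             \sum_(k < (depth (pb x)).+1) 2 ^ (depth (pb x) - k) * bwork k)%N.
  by apply: leq_sum => k _; rewrite leq_mul2l size_bound_box_work ?orbT.
rewrite chain in w2 w3; rewrite /f; lia.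
Qed.

Lemma compressed_kind_work k e : compressed_kind s r k e ->
  (op_cost (unit_machine (R := R) (F := F)) e <= bwork k)%N.
Proof.
rewrite /compressed_kind /box_work; case: eqP => [-> | _] e_ok.
  apply: leq_trans (dense_cost (@unit_cost_conventions R F) (s_gt0 0) e_ok) _.
  by rewrite mul1n leq_pmulr // addn_gt0 !muln_gt0 s_gt0 r_gt0.
apply: leq_trans (compressed_cost (s_gt0 k) _ e_ok) _; first by rewrite muln_gt0 r_gt0.
by rewrite leq_pmull // expn_gt0 s_gt0.
Qed.

Lemma compressed_kind_storage k e : compressed_kind s r k e ->
  (stored_cost (unit_machine (R := R) (F := F)) e <= bstorage k)%N.
Proof.
rewrite /compressed_kind /box_storage; case: eqP => [-> | _] e_ok.
  apply: leq_trans (dense_entries _ e_ok) _.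
  apply: (@leq_trans (s 0%N ^ 3)); first by rewrite leq_pexp2l.
  by rewrite leq_pmulr // !muln_gt0 s_gt0 r_gt0.
apply: leq_trans (compressed_entries (s_gt0 k) _ e_ok) _.
  by rewrite muln_gt0 r_gt0.
by rewrite leq_pmull // expn_gt0 s_gt0.
Qed.

Lemma comp_cost_conventions md x :
  comp_hyp cs eps nmax md x -> cost_conventions (c_cost cs) (mach x).
Proof. by case=> -[]. Qed.

Lemma comp_work_rate md (tr : instance R F -> seq (event R F)) md' n
    (b : nat -> R) (K K' : R) (g : R -> R) :
  (forall x, comp_hyp cs eps nmax md x ->
    charged (compressed_kind s r) n (depth (pb x))
      (box_count md' (depth (pb x))) (tr x) /\
    hss_linear (c_hss cs) (mach x) (tr x)) ->
  0 <= K ->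
  (forall d, (\sum_(k < d.+1) box_count md' d k * bwork k)%:R <= K * b d) ->
  (forall d, (0 < d)%N -> b d <= K' * g (nmax * 2 ^ d)%:R) ->
  isO (comp_hyp cs eps nmax md) (fun x => work (mach x) (tr x)) g.
Proof.
move=> ch K0 sum_le rate.
pose f d := (\sum_(k < d.+1) box_count md' d k * bwork k)%N.
apply: (isO_depth (f := f) (c := ((c_cost cs + c_hss cs) * n)%N) _ K0 sum_le rate).
  exact: comp_setting.
move=> x hx; have [c lin] := ch x hx.
apply: leq_trans (hss_linear_work (comp_cost_conventions hx) lin) _.
by rewrite -mulnA leq_mul2l work_weight (c _ _ compressed_kind_work) orbT.
Qed.

Lemma comp_storage_rate md (tr : instance R F -> seq (event R F)) md' n
    (b : nat -> R) (K K' : R) (g : R -> R) :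
  (forall x, comp_hyp cs eps nmax md x ->
    charged (compressed_kind s r) n (depth (pb x))
      (box_count md' (depth (pb x))) (tr x) /\
    hss_linear (c_hss cs) (mach x) (tr x)) ->
  0 <= K ->
  (forall d, (\sum_(k < d.+1) box_count md' d k * bstorage k)%:R <= K * b d) ->
  (forall d, (0 < d)%N -> b d <= K' * g (nmax * 2 ^ d)%:R) ->
  isO (comp_hyp cs eps nmax md) (fun x => storage (mach x) (tr x)) g.
Proof.
move=> ch K0 sum_le rate.
pose f d := (\sum_(k < d.+1) box_count md' d k * bstorage k)%N.
apply: (isO_depth (f := f) (c := ((1 + c_hss cs) * n)%N) _ K0 sum_le rate).
  exact: comp_setting.
move=> x hx; have [c lin] := ch x hx.
apply: leq_trans (hss_linear_storage lin) _.
by rewrite -mulnA leq_mul2l storage_weight (c _ _ compressed_kind_storage) orbT.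
Qed.

(** Storage needs no sum of its own, as it is at most twice the work bound box by box. *)
Lemma comp_linear md (tr : instance R F -> seq (event R F)) n :
  (forall x, comp_hyp cs eps nmax md x ->
    charged (compressed_kind s r) n (depth (pb x))
      (box_count NTI (depth (pb x))) (tr x) /\
    hss_linear (c_hss cs) (mach x) (tr x)) ->
  isO (comp_hyp cs eps nmax md) (fun x => work (mach x) (tr x)) (fun N => N) /\
  isO (comp_hyp cs eps nmax md) (fun x => storage (mach x) (tr x)) (fun N => N).
Proof.
move=> ch.
pose K := box_const (size_const (C_sk cs) nmax)
            (rank_const (C_rank cs) (c_tool cs) nmax) * 112.
have K0 : 0 <= K by rewrite mulr_ge0 ?box_const_ge0.
have sum_le d : (\sum_(k < d.+1) 2 ^ (d - k) * bwork k)%:R <= K * 2 ^+ d :> R.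
  exact: sum_box_work.
split.
- exact: (comp_work_rate (md' := NTI) ch K0 sum_le (fun d _ => linear_rate d)).
- apply: (comp_storage_rate (md' := NTI) (K := 2 * K) ch _ _
             (fun d _ => linear_rate d)).
    by rewrite mulr_ge0.
  move=> d; rewrite -mulrA; apply: le_trans (ler_wpM2l _ (sum_le d)) => //.
  rewrite -natrM ler_nat big_distrr /=; apply: leq_sum => k _.
  by rewrite mulnCA leq_mul2l box_storage_work ?orbT.
Qed.

(** Only the inverse compression keeps the count of its mode, the source of its sublinear rates: the
    tree build computes indices for every box, and the apply visits every box. *)
Lemma comp_events_charged md x : comp_hyp cs eps nmax md x ->
  let tb := tools x in let P := pb x in
  [/\ charged (compressed_kind s r) 13 (depth P) (box_count NTI (depth P))
        (comp_tree_build tb eps md P) /\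
      hss_linear (c_hss cs) (mach x) (comp_tree_build tb eps md P),
      charged (compressed_kind s r) 43 (depth P) (box_count md (depth P))
        (comp_inverse_compression tb eps md P) /\
      hss_linear (c_hss cs) (mach x) (comp_inverse_compression tb eps md P) &
      charged (compressed_kind s r) 62 (depth P) (box_count NTI (depth P))
        (hss_apply tb eps md P (rhs x)) /\
      hss_linear (c_hss cs) (mach x) (hss_apply tb eps md P (rhs x))].
Proof.
move=> hx tb P; have P_sized := comp_sized hx.
have rk := comp_hyp_ranked eps_gt0 nmax_gt0 hx.
have [_ tok [_ lin] _] := hx.
have rec_rank X Y A : (lrk (tb_rec tb eps X Y A) <= lrk A)%N.
  by have [_ _ _ _ /(_ A)[]] := tok eps X Y eps_gt0.
have [lin1 /hss_linear_cat[lin2 lin3]] := hss_linear_cat lin.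
split; split=> //.
- have [t1 [t2 [-> c1 c2]]] := comp_tree_build_charged P_sized rk.
  apply: (@charged_cat _ _ _ 1 12); last exact: charged_all_boxes c2.
  apply: charged_impl c1 => k e /andP[e_fits e_idx].
  have {}e_fits := fits_rank (leq_pmull (r k) (isT : 0 < 4)%N) e_fits.
  by rewrite /compressed_kind e_fits index_dense // index_compressed // if_same.
- apply: comp_inv_charged => //; rewrite subnn; by case: (md).
- exact: hss_apply_charged.
Qed.
End Rates.

Theorem proposition4p2 (R : realType) (F : numFieldType) (eps : F)
    (nmax : nat) (cs : constants R) (eps_gt0 : 0 < eps)
    (nmax_gt0 : (0 < nmax)%N) :
  let dense (md : mode) := isO (dense_hyp cs eps nmax md) in
  let comp (md : mode) := isO (comp_hyp cs eps nmax md) in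
  let tree (md : mode) (x : instance R F) :=
    comp_tree_build (tools x) eps md (pb x) in
  let inv (md : mode) (x : instance R F) :=
    comp_inverse_compression (tools x) eps md (pb x) in
  let apply (md : mode) (x : instance R F) :=
    hss_apply (tools x) eps md (pb x) (rhs x) in
  let linear (md : mode) :=
    [/\ comp md (fun x => work (mach x) (tree md x)) (fun N => N),
        comp md (fun x => work (mach x) (inv md x)) (fun N => N) &
        comp md (fun x => work (mach x) (apply md x)) (fun N => N)] /\
    [/\ comp md (fun x => storage (mach x) (tree md x)) (fun N => N),
        comp md (fun x => storage (mach x) (inv md x)) (fun N => N) &
        comp md (fun x => storage (mach x)
                   (comp_events (tools x) eps md (pb x) (rhs x)))
                (fun N => N)] in
  [/\ [/\ forall md,
            dense md (fun x => work (mach x) (dense_tree_build md (pb x)))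
                     (fun N => N `^ (3 / 2)) /\
            dense md (fun x => work (mach x)
                                 (dense_inverse_compression md (pb x)))
                     (fun N => N `^ (3 / 2)),
          dense NTI (fun x => storage (mach x)
                                (dense_events NTI (pb x) (rhs x)))
                    (fun N => N * log2 N),
          dense TI (fun x => storage (mach x)
                               (dense_events TI (pb x) (rhs x)))
                   (fun N => N) &
          forall md,
            dense md (fun x => work (mach x) (dense_apply md (pb x) (rhs x)))
                     (fun N => N * log2 N)],
      linear NTI &
      [/\ linear TI,
          comp TI (fun x => work (mach x) (inv TI x))
                  (fun N => N `^ (1 / 2) * log2 N ^+ 2) &
          comp TI (fun x => storage (mach x) (inv TI x))
                  (fun N => N `^ (1 / 2) * log2 N)]].

Proof.
move=> dense comp tree inv apply linear.
have lin md : linear md.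
  have tree_ok := @comp_linear R F eps nmax cs nmax_gt0 md (tree md) 13
    (fun x hx => let: And3 h _ _ := comp_events_charged eps_gt0 nmax_gt0 hx in h).
  have inv_ok : isO (comp_hyp cs eps nmax md) (fun x => work (mach x) (inv md x)) id /\
      isO (comp_hyp cs eps nmax md) (fun x => storage (mach x) (inv md x)) id.
    apply: (@comp_linear R F eps nmax cs nmax_gt0 md (inv md) 43) => x hx.
    have [_ [/charged_all_boxes c l] _] := comp_events_charged eps_gt0 nmax_gt0 hx.
    by split.
  have apply_ok := @comp_linear R F eps nmax cs nmax_gt0 md (apply md) 62
    (fun x hx => let: And3 _ _ h := comp_events_charged eps_gt0 nmax_gt0 hx in h).
  (* [118 = 13 + 43 + 62], for the whole run. *)
  have all_ok := @comp_linear R F eps nmax cs nmax_gt0 md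
    (fun x => comp_events (tools x) eps md (pb x) (rhs x)) 118.
  split; split; [by case: tree_ok | by case: inv_ok | by case: apply_ok
                | by case: tree_ok | by case: inv_ok |].
  apply: (all_ok _).2 => x hx.
  have [[c1 _] [/charged_all_boxes c2 _] [c3 _]] :=
    comp_events_charged eps_gt0 nmax_gt0 hx.
  split; last by have [_ _ [_ ?] _] := hx.
  exact: charged_cat c1 (charged_cat c2 c3).
have inv_TI x (hx : comp_hyp cs eps nmax TI x) :=
  let: And3 _ h _ := comp_events_charged eps_gt0 nmax_gt0 hx in h.
have s_ge1 := size_const_ge1 (C_sk cs) nmax.
have r_ge1 := rank_const_ge1 (C_rank cs) (c_tool cs) nmax.
split; [split | exact: lin | split].
- by move=> md; split; [apply: dense_tree_work | apply: dense_inv_work].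
- exact: dense_storage_NTI.
- exact: dense_storage_TI.
- by move=> md; apply: dense_apply_work.
- exact: lin.
- apply: (comp_work_rate (g := fun N => N `^ (1 / 2) * log2 N ^+ 2)
           (b := fun d => d.+1%:R ^+ 2 * Num.sqrt 2 ^+ d) inv_TI
           (mulr_ge0 (box_const_ge0 s_ge1 r_ge1) (ler0n R 4))
           _ (fun d d0 => sqrt_log_rate nmax_gt0 2 d0)) => d.
  under eq_bigr do rewrite mul1n.
  exact: sum_box_work_chain.
(* Storage is linear in the rank, hence a single logarithm; the exponent 1 is written out to share
   [sqrt_log_rate] with the work bound. *)
- apply: (comp_storage_rate (g := fun N => N `^ (1 / 2) * log2 N)
           (b := fun d => d.+1%:R ^+ 1 * Num.sqrt 2 ^+ d) inv_TI _ _
           (fun d d0 => sqrt_log_rate nmax_gt0 1 d0)) => [|d]; last first.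
    under eq_bigr do rewrite mul1n.
    exact: sum_box_storage_chain.
  by rewrite !mulr_ge0 // (le_trans ler01).
Qed.
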